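(* Let $M$ be a smooth manifold of real dimension $4n$ with a generalized hypercomplex structure, with $S^2$-family $\{\mathcal I_{\mathbf a}\}_{\mathbf a\in S^2}$, and let $Z=M\times S^2$ be its twistor space with its generalized complex structure $\mathbb I$. (1) If the type of $\mathbb I$ is $2n+1$ on some open set $W\subset Z$, then the family is locally a $B$-twisted hypercomplex structure: for every $(x,\mathbf a_0)\in W$ there is a neighbourhood $U$ of $x$ in $M$ on which $\{\mathcal I_{\mathbf a}\}$ is a $B$-twisted hypercomplex structure. (2) If the type of $\mathbb I$ is $1$ at a point $(x,\mathbf a_0)\in Z$, then there are a neighbourhood $U$ of $x$ in $M$, a closed $2$-form $B_0$ on $U$, symplectic forms $\omega_1,\omega_2$ on $U$, a closed $2$-form $B$ on $U$, and a real number $p$ with $|p|<1$, such that the two structures $$\mathcal I_1=\begin{pmatrix}0&-\omega_1^{-1}\\ \omega_1&0\end{pmatrix},\qquad \mathcal I_2=\begin{pmatrix}\omega_2^{-1}B&-\omega_2^{-1}\\ \omega_2+B\omega_2^{-1}B&-B\omega_2^{-1}\end{pmatrix}$$ satisfy $\mathcal I_1\mathcal I_2+\mathcal I_2\mathcal I_1=2p\,\mathrm{Id}$, the endomorphisms $A=B\omega_2^{-1}$ and $D=\omega_1\omega_2^{-1}+p\,\mathrm{Id}$ of $T^*U$ satisfy $A^2+D^2=(p^2-1)\mathrm{Id}$ and $AD=DA$, and the family $\{\mathcal I_{\mathbf a}\}$ restricted to $U$ is the image under $Ad(\exp(B_0))$ of the generalized hypercomplex family determined by $\mathcal I_1,\mathcal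 I_2$. (3) If, in addition to the situation of (2), there are real numbers $a,b,c$, not all zero, with $cB=a\omega_2+b\omega_1$, and real numbers $\gamma$ and $\theta<0$ with $(\omega_2^{-1}\omega_1+\gamma\,\mathrm{Id})^2=\theta\,\mathrm{Id}$, then (after possibly shrinking $U$) the structure on $U$ is a $B$-transformed holomorphic symplectic structure.
   Context: On $TM\oplus T^*M$ consider the pairing $\langle X+\xi,Y+\eta\rangle=\frac12(\xi(Y)+\eta(X))$ and the Courant bracket $[X+\xi,Y+\eta]=[X,Y]+L_X\eta-L_Y\xi-\frac12 d(i_X\eta-i_Y\xi)$. A generalized almost complex structure is an endomorphism $\mathcal I$ of $TM\oplus T^*M$, orthogonal for the pairing, with $\mathcal I^2=-\mathrm{Id}$; it is a generalized complex structure if its $\sqrt{-1}$-eigenbundle $L$ is closed under the Courant bracket. Type: at each point, $L$ is the annihilator (under $(X+\xi)\cdot\rho=i_X\rho+\xi\wedge\rho$) of a complex form $\rho=e^{B+i\omega}\Omega$ with $B,\omega$ real $2$-forms and $\Omega$ a decomposable complex form; the type at that point is $\deg\Omega$. A generalized hypercomplex structure is a triple of pairwise anti-commuting generalized complex structures $(\mathcal I,\mathcal J,\mathcal K=\mathcal I\mathcal J)$ such that all $\mathcal I_{\mathbf a}=a\mathcal I+b\mathcal J+c\mathcal K$, $\mathbf a=(a,b,c)\in S^2$, are generalized complex structures; structures with the same $S^2$-family are identified. If two distinct non-opposite generalized complex structures $\mathcal I_1,\mathcal I_2$ satisfy $\mathcal I_1\mathcal I_2+\mathcal I_2\mathcal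 I_1=2p\,\mathrm{Id}$ with a constant $|p|<1$, they belong to a unique generalized hypercomplex family: the unit sphere family in the span of $\mathcal I_1,\mathcal I_2,[\mathcal I_1,\mathcal I_2]$; this is the family determined by $\mathcal I_1,\mathcal I_2$. Twistor space: $Z=M\times S^2$ with $\mathbb I|_{(x,\mathbf a)}=\mathcal I_{\mathbf a}|_{T_xM\oplus T_x^*M}\oplus\mathcal J_{S^2}|_{T_{\mathbf a}S^2\oplus T^*_{\mathbf a}S^2}$, where $\mathcal J_{S^2}=\begin{pmatrix}-j&0\\ 0&j^*\end{pmatrix}$ is the generalized complex structure determined by the complex structure $j$ of $S^2\cong\mathbb{CP}^1=\mathbb C\cup\{\infty\}$, the identification being $\lambda\mapsto\left(\frac{1-|\lambda|^2}{1+|\lambda|^2},\frac{i(\bar\lambda-\lambda)}{1+|\lambda|^2},\frac{\lambda+\bar\lambda}{1+|\lambda|^2}\right)$. Matrices are written with respect to $TM\oplus T^*M$; $2$-forms are regarded as maps $TM\to T^*M$, and $J^*$ denotes the dual of $J$. For a $2$-form $B$, $Ad(\exp(B))\mathcal I=\begin{pmatrix}1&0\\ B&1\end{pmatrix}\mathcal I\begin{pmatrix}1&0\\ -B&1\end{pmatrix}$. A complex structure $J$ induces the generalized complex structure $\begin{pmatrix}J&0\\ 0&-J^*\end{pmatrix}$. A generalized hypercomplex family $\{\mathcal I_{a,b,c}\}$ is $B$-twisted hypercomplex on $U$ if $\mathcal I_{a,b,c}=Ad(\exp(B+B_{a,b,c}))I_{a,b,c}$ for all $(a,b,c)\in S^2$,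 where: (i) the $I_{a,b,c}$ are generalized complex structures induced by complex structures on $U$ which form a usual hypercomplex family; (ii) $B$ is a fixed $2$-form on $U$ independent of $(a,b,c)$; (iii) $B_{a,b,c}$ are $2$-forms depending on $(a,b,c)$, of type $(2,0)+(0,2)$ with respect to the complex structure underlying $I_{a',b',c'}$ for every $(a',b',c')\in S^2$. A generalized hypercomplex structure on $U$ is $B$-transformed holomorphic symplectic if there are a closed $2$-form $B'$, a complex structure $J$ and a symplectic form $\omega$ on $U$ with $J^*\omega=\omega J$ and with $\omega+i\,\omega J$ or its complex conjugate a holomorphic symplectic form for $J$, such that its family is the image under $Ad(\exp(B'))$ of the family determined by $\begin{pmatrix}J&0\\ 0&-J^*\end{pmatrix}$ and $\begin{pmatrix}0&-\omega^{-1}\\ \omega&0\end{pmatrix}$. *)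

(* Defs.v *)
From HB Require Import structures.
From mathcomp Require Import all_boot all_order all_algebra.
From mathcomp Require Import all_classical all_reals all_analysis.
From mathcomp Require Import complex.

Set Implicit Arguments.
Unset Strict Implicit.
Unset Printing Implicit Defensive.

Import Order.TTheory GRing.Theory Num.Theory.
Import numFieldNormedType.Exports.

Local Open Scope classical_set_scope.
Local Open Scope ring_scope.

(* Points of R^m are column vectors. *)
Definition partial (R : realType) (m : nat) (i : 'I_m) (f : 'cV[R]_m -> R)
    (u : 'cV[R]_m) : R :=
  'D_(delta_mx i 0) f u.

Fixpoint Ck_on (R : realType) (m k : nat) (V : set 'cV[R]_m)
    (f : 'cV[R]_m -> R) : Prop :=
  (forall u, V u -> {for u, continuous f}) /\
  match k with
  | 0%N => True
  | k'.+1 => forall i : 'I_m,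
      (forall u, V u -> derivable f u (delta_mx i 0)) /\
      Ck_on k' V (partial i f)
  end.

Definition smooth_on (R : realType) (m : nat) (V : set 'cV[R]_m)
    (f : 'cV[R]_m -> R) : Prop :=
  forall k, Ck_on k V f.

(* A Hausdorff, second countable space with a smooth atlas: crd c is a
   coordinate map with domain dom c and par c its inverse (values outside
   dom c, resp. outside its image, are meaningless). *)
Record smooth_manifold (R : realType) (m : nat) := SmoothManifold {
  carrier :> topologicalType;
  chart : Type;
  dom : chart -> set carrier;
  crd : chart -> carrier -> 'cV[R]_m;
  par : chart -> 'cV[R]_m -> carrier;
  mfd_hausdorff : hausdorff_space carrier;
  mfd_second_countable : @second_countable carrier;
  dom_open : forall c, open (dom c);
  crd_open : forall c, open (crd c @` dom c);
  crdK : forall c x, dom c x -> par c (crd c x) = x;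
  crd_continuous : forall c x, dom c x -> {for x, continuous (crd c)};
  par_continuous : forall c u, (crd c @` dom c) u -> {for u, continuous (par c)};
  dom_cover : forall x, exists c, dom c x;
  transition_smooth : forall c c' (i : 'I_m),
    smooth_on (crd c @` (dom c `&` dom c')) (fun u => crd c' (par c u) i 0)
}.

(* Tensor fields are given by their components in every chart: F c x is the
   matrix at x with respect to the coordinate frame of the chart c, and only
   matters for x in dom c (and in the open set on which the field lives).
   Tangent vectors and covectors are columns, so the dual of an endomorphism
   is its transpose. *)
Definition tfield (R : realType) (m : nat) (M : smooth_manifold R m) (k l : nat) :=
  chart M -> M -> 'M[R]_(k, l).

Definition trans (R : realType) (m : nat) (M : smooth_manifold R m)
    (c c' : chart M) (x : M) : 'M[R]_m :=
  \matrix_(i, j) partial j (fun u => crd c' (par c u) i 0) (crd c x).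

Definition smooth_field (R : realType) (m : nat) (M : smooth_manifold R m)
    (k l : nat) (U : set M) (F : tfield M k l) : Prop :=
  forall c i j, smooth_on (crd c @` (dom c `&` U)) (fun u => F c (par c u) i j).

Definition dfield (R : realType) (m : nat) (M : smooth_manifold R m)
    (k l : nat) (F : tfield M k l) (c : chart M) (x : M) (i : 'I_m)
    (a : 'I_k) (b : 'I_l) : R :=
  partial i (fun u => F c (par c u) a b) (crd c x).

Definition everywhere (R : realType) (m : nat) (M : smooth_manifold R m)
    (U : set M) (P : chart M -> M -> Prop) : Prop :=
  forall c x, U x -> dom c x -> P c x.

(* 2-forms are seen as maps TM -> T*M, X |-> i_X B: the matrix entry (j, i) is
   B(d_i, d_j), and B(X, Y) = Y^T *m B *m X. *)
Definition form2 (R : realType) (m : nat) (M : smooth_manifold R m)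
    (U : set M) (B : tfield M m m) : Prop :=
  [/\ smooth_field U B,
      everywhere U (fun c x => (B c x)^T = - B c x) &
      forall c c' x, U x -> dom c x -> dom c' x ->
        (trans c c' x)^T *m B c' x *m trans c c' x = B c x].

Definition closed_form2 (R : realType) (m : nat) (M : smooth_manifold R m)
    (U : set M) (B : tfield M m m) : Prop :=
  form2 U B /\
  everywhere U (fun c x => forall i j k : 'I_m,
    dfield B c x i j k + dfield B c x j k i + dfield B c x k i j = 0).

Definition symplectic (R : realType) (m : nat) (M : smooth_manifold R m)
    (U : set M) (w : tfield M m m) : Prop :=
  closed_form2 U w /\ everywhere U (fun c x => w c x \in unitmx).

(* Integrability is the vanishing of the Nijenhuis tensor, whose components
   N(d_i, d_j)^k are given here. *)
Definition nijenhuis (R : realType) (m : nat) (M : smooth_manifold R m)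
    (J : tfield M m m) (c : chart M) (x : M) (i j k : 'I_m) : R :=
  \sum_l (J c x l i * dfield J c x l k j - J c x l j * dfield J c x l k i)
  - \sum_l J c x k l * (dfield J c x i l j - dfield J c x j l i).

Definition complex_structure (R : realType) (m : nat) (M : smooth_manifold R m)
    (U : set M) (J : tfield M m m) : Prop :=
  [/\ smooth_field U J,
      forall c c' x, U x -> dom c x -> dom c' x ->
        J c' x *m trans c c' x = trans c c' x *m J c x,
      everywhere U (fun c x => J c x *m J c x = - 1%:M) &
      everywhere U (fun c x => forall i j k, nijenhuis J c x i j k = 0)].

Definition toC (R : realType) (k l : nat) (A : 'M[R]_(k, l)) : 'M[R[i]]_(k, l) :=
  map_mx (real_complex R) A.

(* The real 2-form B is of type (2,0)+(0,2) for J: B(Z, W) = 0 for Z of type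
   (1,0) and W of type (0,1). *)
Definition type20_02 (R : realType) (m : nat) (J B : 'M[R]_m) : Prop :=
  forall Z W : 'cV[R[i]]_m,
    toC J *m Z = 'i%C *: Z -> toC J *m W = - 'i%C *: W ->
    W^T *m toC B *m Z = 0.

(* re + i im is a holomorphic symplectic form: closed, of type (2,0) (hence
   holomorphic, d-closed (2,0)-forms being dbar-closed) and nondegenerate on
   (1,0)-vectors. *)
Definition holomorphic_symplectic (R : realType) (m : nat)
    (M : smooth_manifold R m) (U : set M) (J re im : tfield M m m) : Prop :=
  [/\ closed_form2 U re, closed_form2 U im,
      everywhere U (fun c x => forall W : 'cV[R[i]]_m,
        toC (J c x) *m W = - 'i%C *: W ->
        (toC (re c x) + 'i%C *: toC (im c x)) *m W = 0) &
      everywhere U (fun c x => forall Z : 'cV[R[i]]_m,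
        toC (J c x) *m Z = 'i%C *: Z ->
        (toC (re c x) + 'i%C *: toC (im c x)) *m Z = 0 -> Z = 0)].

(* Lie bracket, Lie derivative and Courant bracket are extended complex
   bilinearly, in coordinates. *)
Definition partialC (R : realType) (m : nat) (i : 'I_m)
    (f : 'cV[R]_m -> R[i]) (u : 'cV[R]_m) : R[i] :=
  Complex (partial i (fun v => complex.Re (f v)) u)
          (partial i (fun v => complex.Im (f v)) u).

Definition smoothC_on (R : realType) (m k : nat) (V : set 'cV[R]_m)
    (s : 'cV[R]_m -> 'cV[R[i]]_k) : Prop :=
  forall i : 'I_k, smooth_on V (fun u => complex.Re (s u i 0)) /\
                   smooth_on V (fun u => complex.Im (s u i 0)).

Definition lie_bracket (R : realType) (m : nat)
    (X Y : 'cV[R]_m -> 'cV[R[i]]_m) (u : 'cV[R]_m) : 'cV[R[i]]_m :=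
  \col_i \sum_j (X u j 0 * partialC j (fun v => Y v i 0) u
                 - Y u j 0 * partialC j (fun v => X v i 0) u).

Definition lie_derivative (R : realType) (m : nat)
    (X eta : 'cV[R]_m -> 'cV[R[i]]_m) (u : 'cV[R]_m) : 'cV[R[i]]_m :=
  \col_i \sum_j (X u j 0 * partialC j (fun v => eta v i 0) u
                 + eta u j 0 * partialC i (fun v => X v j 0) u).

Definition contract (R : realType) (m : nat)
    (X eta : 'cV[R]_m -> 'cV[R[i]]_m) (u : 'cV[R]_m) : R[i] :=
  \sum_j X u j 0 * eta u j 0.

Definition courant (R : realType) (m : nat)
    (s t : 'cV[R]_m -> 'cV[R[i]]_(m + m)) (u : 'cV[R]_m) : 'cV[R[i]]_(m + m) :=
  let X := fun v => usubmx (s v) in let xi := fun v => dsubmx (s v) in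
  let Y := fun v => usubmx (t v) in let eta := fun v => dsubmx (t v) in
  col_mx (lie_bracket X Y u)
    (lie_derivative X eta u - lie_derivative Y xi u
     - 2%:R^-1 *: \col_i partialC i (fun v => contract X eta v - contract Y xi v) u).

Definition pairing_mx (R : realType) (m : nat) : 'M[R]_(m + m) :=
  block_mx 0 (2%:R^-1)%:M (2%:R^-1)%:M 0.

Definition gtrans (R : realType) (m : nat) (M : smooth_manifold R m)
    (c c' : chart M) (x : M) : 'M[R]_(m + m) :=
  block_mx (trans c c' x) 0 0 (invmx (trans c c' x)^T).

Definition gen_almost_complex (R : realType) (m : nat) (M : smooth_manifold R m)
    (U : set M) (E : tfield M (m + m) (m + m)) : Prop :=
  [/\ smooth_field U E,
      forall c c' x, U x -> dom c x -> dom c' x ->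
        E c' x *m gtrans c c' x = gtrans c c' x *m E c x,
      everywhere U (fun c x =>
        (E c x)^T *m pairing_mx R m *m E c x = pairing_mx R m) &
      everywhere U (fun c x => E c x *m E c x = - 1%:M)].

Definition eigen_section (R : realType) (m : nat) (M : smooth_manifold R m)
    (E : tfield M (m + m) (m + m)) (c : chart M) (V : set 'cV[R]_m)
    (s : 'cV[R]_m -> 'cV[R[i]]_(m + m)) : Prop :=
  forall u, V u -> toC (E c (par c u)) *m s u = 'i%C *: s u.

(* Closedness of the i-eigenbundle is tested on local sections over open
   subsets of coordinate domains, read in the corresponding chart. *)
Definition gen_complex (R : realType) (m : nat) (M : smooth_manifold R m)
    (U : set M) (E : tfield M (m + m) (m + m)) : Prop :=
  gen_almost_complex U E /\
  forall (c : chart M) (V : set 'cV[R]_m) (s t : 'cV[R]_m -> 'cV[R[i]]_(m + m)),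
    open V -> V `<=` crd c @` (dom c `&` U) ->
    smoothC_on V s -> smoothC_on V t ->
    eigen_section E c V s -> eigen_section E c V t ->
    eigen_section E c V (courant s t).

Definition gc_of_complex (R : realType) (m : nat) (M : smooth_manifold R m)
    (J : tfield M m m) : tfield M (m + m) (m + m) :=
  fun c x => block_mx (J c x) 0 0 (- (J c x)^T).

Definition gc_of_symplectic (R : realType) (m : nat) (M : smooth_manifold R m)
    (w : tfield M m m) : tfield M (m + m) (m + m) :=
  fun c x => block_mx 0 (- invmx (w c x)) (w c x) 0.

Definition Ad_exp (R : realType) (m : nat) (M : smooth_manifold R m)
    (B : tfield M m m) (E : tfield M (m + m) (m + m)) : tfield M (m + m) (m + m) :=
  fun c x => block_mx 1%:M 0 (B c x) 1%:M *m E c x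
             *m block_mx 1%:M 0 (- B c x) 1%:M.

(* Complex exterior forms on R^N; r S is the coefficient of the increasing
   product of the dx_i, i in S. *)
Definition cform (R : realType) (N : nat) := {ffun {set 'I_N} -> R[i]}.

Definition one_form (R : realType) (N : nat) : cform R N :=
  [ffun S => (S == finset.set0)%:R].

Definition nbelow (N : nat) (i : 'I_N) (S : {set 'I_N}) : nat :=
  #|[set j in S | (j < i)%N]|%SET.

Definition wedge1 (R : realType) (N : nat) (xi : 'cV[R[i]]_N) (r : cform R N) :
    cform R N :=
  [ffun S : {set 'I_N} =>
    \sum_(i in S) (-1) ^+ nbelow i S * xi i 0 * r (S :\ i)%SET].

Definition interior_mul (R : realType) (N : nat) (X : 'cV[R[i]]_N) (r : cform R N) :
    cform R N :=
  [ffun S : {set 'I_N} =>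
    \sum_(i | i \notin S) (-1) ^+ nbelow i S * X i 0 * r (i |: S)%SET].

Definition clifford (R : realType) (N : nat) (v : 'cV[R[i]]_(N + N))
    (r : cform R N) : cform R N :=
  interior_mul (usubmx v) r + wedge1 (dsubmx v) r.

(* Exterior product with the 2-form of matrix B, that is, with
   (1/2) sum_(i, j) B(d_i, d_j) dx_i /\ dx_j. *)
Definition wedge2 (R : realType) (N : nat) (B : 'M[R[i]]_N) (r : cform R N) :
    cform R N :=
  2%:R^-1 *: \sum_i \sum_j
    B j i *: wedge1 (delta_mx i 0) (wedge1 (delta_mx j 0) r).

(* Powers of B beyond the N-th vanish. *)
Definition exp_wedge (R : realType) (N : nat) (B : 'M[R[i]]_N) (r : cform R N) :
    cform R N :=
  \sum_(k < N.+1) (k`!%:R)^-1 *: iter k (wedge2 B) r.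

Definition decomposable (R : realType) (N : nat) (th : seq 'cV[R[i]]_N) :
    cform R N :=
  foldr (@wedge1 R N) (one_form R N) th.

Definition has_type (R : realType) (N : nat) (E : 'M[R]_(N + N)) (k : nat) :
    Prop :=
  exists (B w : 'M[R]_N) (th : k.-tuple 'cV[R[i]]_N),
    [/\ B^T = - B, w^T = - w, decomposable th != 0 &
        forall v : 'cV[R[i]]_(N + N),
          toC E *m v = 'i%C *: v <->
          clifford v (exp_wedge (toC B + 'i%C *: toC w) (decomposable th)) = 0].

Definition S2 (R : realType) : set (R * R * R) :=
  [set a | a.1.1 ^+ 2 + a.1.2 ^+ 2 + a.2 ^+ 2 = 1].

Definition s2family (R : realType) (m : nat) (M : smooth_manifold R m) (k l : nat)
    (I J K : tfield M k l) (a : R * R * R) : tfield M k l :=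
  fun c x => a.1.1 *: I c x + a.1.2 *: J c x + a.2 *: K c x.

Definition quaternionic (R : realType) (m : nat) (M : smooth_manifold R m)
    (k : nat) (U : set M) (I J K : tfield M k k) : Prop :=
  everywhere U (fun c x =>
    [/\ I c x *m J c x = K c x,
        I c x *m J c x = - (J c x *m I c x),
        I c x *m K c x = - (K c x *m I c x) &
        J c x *m K c x = - (K c x *m J c x)]).

Definition gen_hypercomplex (R : realType) (m : nat) (M : smooth_manifold R m)
    (U : set M) (I J K : tfield M (m + m) (m + m)) : Prop :=
  [/\ gen_complex U I, gen_complex U J, gen_complex U K, quaternionic U I J K &
      forall a, S2 a -> gen_complex U (s2family I J K a)].

Definition hypercomplex (R : realType) (m : nat) (M : smooth_manifold R m)
    (U : set M) (I J K : tfield M m m) : Prop :=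
  [/\ complex_structure U I, complex_structure U J, complex_structure U K,
      quaternionic U I J K &
      forall a, S2 a -> complex_structure U (s2family I J K a)].

(* T belongs to the family determined by I1 and I2: T^2 = - Id cuts out the
   unit sphere of the span. *)
Definition determined (R : realType) (m : nat) (M : smooth_manifold R m)
    (U : set M) (I1 I2 T : tfield M (m + m) (m + m)) : Prop :=
  (exists al be ga : R, everywhere U (fun c x =>
     T c x = al *: I1 c x + be *: I2 c x
             + ga *: (I1 c x *m I2 c x - I2 c x *m I1 c x))) /\
  everywhere U (fun c x => T c x *m T c x = - 1%:M).

(* On U, the S^2-family F is the image under Ad(exp(B)) of the family
   determined by I1 and I2. *)
Definition Ad_determined (R : realType) (m : nat) (M : smooth_manifold R m)
    (U : set M) (F : R * R * R -> tfield M (m + m) (m + m))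
    (B : tfield M m m) (I1 I2 : tfield M (m + m) (m + m)) : Prop :=
  (forall a, S2 a -> exists T, determined U I1 I2 T /\
     everywhere U (fun c x => F a c x = Ad_exp B T c x)) /\
  (forall T, determined U I1 I2 T -> exists a, S2 a /\
     everywhere U (fun c x => F a c x = Ad_exp B T c x)).

Definition twisted_hypercomplex (R : realType) (m : nat)
    (M : smooth_manifold R m) (U : set M)
    (F : R * R * R -> tfield M (m + m) (m + m)) : Prop :=
  exists (I J K B : tfield M m m) (Bs : R * R * R -> tfield M m m),
    [/\ hypercomplex U I J K,
        form2 U B,
        forall a, S2 a -> form2 U (Bs a),
        forall a a', S2 a -> S2 a' ->
          everywhere U (fun c x => type20_02 (s2family I J K a' c x) (Bs a c x)) &
        forall a, S2 a -> everywhere U (fun c x =>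
          F a c x = Ad_exp (fun c x => B c x + Bs a c x)
                           (gc_of_complex (s2family I J K a)) c x)].

Definition transformed_holomorphic_symplectic (R : realType) (m : nat)
    (M : smooth_manifold R m) (U : set M)
    (F : R * R * R -> tfield M (m + m) (m + m)) : Prop :=
  exists B' J w : tfield M m m,
    [/\ closed_form2 U B',
        complex_structure U J /\ symplectic U w,
        everywhere U (fun c x => (J c x)^T *m w c x = w c x *m J c x),
        holomorphic_symplectic U J w (fun c x => w c x *m J c x) \/
        holomorphic_symplectic U J w (fun c x => - (w c x *m J c x)) &
        Ad_determined U F B' (gc_of_complex J) (gc_of_symplectic w)].

Definition twistor_space (R : realType) (m : nat) (M : smooth_manifold R m) :
    set (M * (R * R * R)) :=
  [set z | S2 z.2].

Definition open_in_twistor (R : realType) (m : nat) (M : smooth_manifold R m)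
    (W : set (M * (R * R * R))) : Prop :=
  exists O, open O /\ W = O `&` @twistor_space R m M.

(* The point of S^2 with affine coordinate l = lambda (at_infty = false) or
   l = 1 / lambda (at_infty = true) on CP^1; note that
   i (lambda^* - lambda) = 2 Im lambda. *)
Definition sphere_of_CP1 (R : realType) (at_infty : bool) (l : R[i]) : R * R * R :=
  let u := complex.Re l in let v := complex.Im l in
  let q := u ^+ 2 + v ^+ 2 in
  if at_infty then ((q - 1) / (1 + q), - (2%:R * v) / (1 + q), 2%:R * u / (1 + q))
  else ((1 - q) / (1 + q), 2%:R * v / (1 + q), 2%:R * u / (1 + q)).

(* Matrix of j in the frame (d/du, d/dv) of an affine coordinate u + i v of
   CP^1: multiplication by i. *)
Definition j_mx (R : realType) : 'M[R]_2 := \matrix_(a, b)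
  (if (a == 0) && (b == 1) then -1 else if (a == 1) && (b == 0) then 1 else 0).

(* Matrix of E + J_(S^2) in the frame (d/dx_1, .., d/dx_m, d/du, d/dv) of
   T(M x S^2) and its dual frame, where J_(S^2) = diag(- j, j^T). *)
Definition twistor_mx (R : realType) (m : nat) (E : 'M[R]_(m + m)) :
    'M[R]_((m + 2) + (m + 2)) :=
  block_mx (block_mx (ulsubmx E) 0 0 (- j_mx R)) (block_mx (ursubmx E) 0 0 0)
           (block_mx (dlsubmx E) 0 0 0) (block_mx (drsubmx E) 0 0 (j_mx R)^T).

Definition twistor_type (R : realType) (m : nat) (M : smooth_manifold R m)
    (F : R * R * R -> tfield M (m + m) (m + m)) (x : M) (a : R * R * R)
    (k : nat) : Prop :=
  exists (c : chart M) (at_infty : bool) (l : R[i]),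
    [/\ dom c x, sphere_of_CP1 at_infty l = a & has_type (twistor_mx (F a c x)) k].

(* This is Ad(exp(B)) of the structure of w. *)
Definition gc_of_B_symplectic (R : realType) (m : nat) (M : smooth_manifold R m)
    (w B : tfield M m m) : tfield M (m + m) (m + m) :=
  fun c x => let w' := invmx (w c x) in let b := B c x in
    block_mx (w' *m b) (- w') (w c x + b *m w' *m b) (- (b *m w')).

Definition symplectic_normal_form (R : realType) (m : nat)
    (M : smooth_manifold R m) (F : R * R * R -> tfield M (m + m) (m + m))
    (x : M) (U : set M) (B0 w1 w2 B : tfield M m m) (p : R) : Prop :=
  let I1 := gc_of_symplectic w1 in
  let I2 := gc_of_B_symplectic w2 B in
  let A c y := B c y *m invmx (w2 c y) in
  let D c y := w1 c y *m invmx (w2 c y) + p%:M in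
  [/\ [/\ open U, U x & `|p| < 1],
      [/\ closed_form2 U B0, symplectic U w1, symplectic U w2 & closed_form2 U B],
      everywhere U (fun c y =>
        I1 c y *m I2 c y + I2 c y *m I1 c y = (2%:R * p)%:M),
      everywhere U (fun c y =>
        A c y *m A c y + D c y *m D c y = (p ^+ 2 - 1)%:M /\
        A c y *m D c y = D c y *m A c y) &
      Ad_determined U F B0 I1 I2].

(* Main.v *)
Require Import Defs.
From HB Require Import structures.
From mathcomp Require Import all_boot all_order all_algebra.
From mathcomp Require Import all_classical all_reals all_analysis.
From mathcomp Require Import complex.
From mathcomp Require Import ring lra zify.

Set Implicit Arguments.
Unset Strict Implicit.
Unset Printing Implicit Defensive.

Import Order.TTheory GRing.Theory Num.Theory.
Import numFieldNormedType.Exports.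

Local Open Scope classical_set_scope.
Local Open Scope ring_scope.

(** In the splitting TM + T*M a generalized almost complex structure is a block
    matrix E = (A, P; S, - A^T) with P and S skew, and everything below is read
    off its upper right block, the bivector P.

    Type and bivector.  If the i-eigenspace L is the annihilator of
    rho = exp(B + i w) th_1 /\ ... /\ th_k, the covectors th_j are linearly
    independent and lie in L.  If k is half the dimension, the th_j and their
    conjugates span the complexified cotangent space, so E preserves it and
    P = 0 (has_type_half).  If k = 1, the covectors of L form a line; on the
    twistor space the sphere already accounts for this line, and a kernel vector
    of P on the M side would produce a second one, so P is invertible
    (twistor_type1).

    Integrability.  If P = 0, Lie brackets of the vector parts of the sections
    (1 - i E) d_a of L show that A is a complex structure (gc_nijenhuis).  If P
    is invertible, put w = - P^-1 and B = w A: then E = Ad(exp B) of the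
    structure of w, L is the graph of C = B - i w, and the Courant bracket of
    the sections d_a + C d_a is the exterior derivative of C; hence dB = dw = 0
    (gc_symplectic).

    The family is a |-> F(a), linear in a, with
    F(a) F(b) = - <a, b> + F(a x b).  Any two independent members therefore
    determine it (Ad_determined_span), and so the three assertions reduce to
    statements about bivectors.

    (1) Vanishing of the bivector of F(a) on an open piece of the sphere forces
    it for all a by linearity.  The diagonal blocks are then a hypercomplex
    family.  The isotropic complements of T* are the graphs of 2-forms, an affine
    space on which the quaternion group of order 8 acts; averaging the complement
    TM over this group gives an invariant complement, the graph of the 2-form B = - 1/4 (S_I J_I + S_J J_J + S_K J_K) (twist_identity).  The forms
    depending on the point of the sphere are taken to be 0.

    (2) If the bivector of F(a0) is invertible at x, so is that of F(a1) for some
    unit vector a1 independent of a0, because the determinant along a line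
    a0 + s e is a nonzero polynomial in s; both remain invertible near x.
    Both structures are then B-transforms of symplectic ones; Ad(exp(- B0))
    brings them to the normal form with p = - <a0, a1>, and the relations between
    A and D are the blocks of the anticommutation relation.

    (3) In positive dimension the hypothesis on N excludes c = 0.  For c <> 0 the bivector of
    (a/c) I1 + (b/c) I2 + [I1, I2]/2 vanishes, so some member F(v) has
    identically vanishing bivector.  A member F(q) with q orthogonal to v has an
    invertible one, and in the gauge where F(q) comes from a symplectic form w,
    anticommutation turns F(v) into a complex structure J with w J = J^T w.  The
    third member F(v x q) is then given by the 2-form - w J, which is closed for
    the same reason as w (holomorphic_symplectic_of_family).

    All tensors are compared between charts, which requires the Jacobians of
    transition maps to be invertible; this is the chain rule for functions with
    continuous partial derivatives (trans_unit). *)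

(** * Differentiability of functions with continuous partial derivatives *)

Lemma is_derive_line (R : realType) (V : normedModType R) (g : V -> R)
    (y v : V) (s : R) :
  derivable g (y + s *: v) v ->
  is_derive s 1 (fun t => g (y + t *: v)) ('D_v g (y + s *: v)).
Proof.
have E : (fun h : R => h^-1 *: (g (h *: v + (y + s *: v)) - g (y + s *: v))) =
         (fun h : R => h^-1 *: (g (y + (h *: 1%R + s) *: v) - g (y + s *: v))).
  apply/funext => h; congr (_ *: (g _ - _)).
  by rewrite scalerDl addrCA /GRing.scale/= mulr1.
move=> dg; apply: DeriveDef.
  by move: dg; rewrite /derivable E.
by rewrite /derive E.
Qed.

(** The mean value theorem along a line, for a step t of either sign. *)
Lemma line_MVT (R : realType) (V : normedModType R) (g : V -> R) (y v : V) (t : R) :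
  (forall s : R, `|s| <= `|t| -> derivable g (y + s *: v) v) ->
  exists2 s, `|s| <= `|t| & g (y + t *: v) - g y = t * 'D_v g (y + s *: v).
Proof.
move=> dg; pose f s := g (y + s *: v); pose df s := 'D_v g (y + s *: v).
have D (s : R) : `|s| <= `|t| -> is_derive s (1 : R) f (df s).
  by move=> /dg; exact: is_derive_line.
have C (a b : R) : (forall s : R, s \in `[a, b]%R -> `|s| <= `|t|) ->
    {within `[a, b], continuous f}.
  move=> ab; apply: derivable_within_continuous => s /ab /D [].
  by [].
have [t0|t0] := leP 0 t.
  have H u : u \in `[0, t]%R -> `|u| <= `|t|.
    by rewrite in_itv/= => /andP[s0 st]; rewrite !ger0_norm.
  have [||c c0 E] := @MVT_segment _ f df 0 t t0.
  - by move=> z zI; apply: D; apply: H; exact: subset_itv_oo_cc.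
  - exact: C.
  exists c; first exact: H.
  by move: E; rewrite /f scale0r addr0 subr0 mulrC.
have H u : u \in `[t, 0]%R -> `|u| <= `|t|.
  by rewrite in_itv/= => /andP[s0 st]; rewrite !ler0_norm ?lerN2 // ltW.
have [||c c0 E] := @MVT_segment _ f df t 0 (ltW t0).
- by move=> z zI; apply: D; apply: H; exact: subset_itv_oo_cc.
- exact: C.
exists c; first exact: H.
move: E; rewrite /f scale0r addr0 sub0r mulrN => /eqP.
by rewrite -[_ - g (y + _)]opprB eqr_opp mulrC => /eqP.
Qed.

Section ContinuousPartials.
Variables (R : realType) (m : nat).
Implicit Types (g : 'cV[R]_m -> R) (y h : 'cV[R]_m).

Definition truncate (k : nat) h : 'cV[R]_m := \col_i (if (i < k)%N then h i 0 else 0).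

Lemma truncate0 h : truncate 0 h = 0.
Proof. by apply/colP => i; rewrite !mxE. Qed.

Lemma truncate_full h : truncate m h = h.
Proof. by apply/colP => i; rewrite mxE ltn_ord. Qed.

Lemma truncateS (k : 'I_m) h :
  truncate k.+1 h = truncate k h + h k 0 *: delta_mx k 0.
Proof.
apply/colP => i; rewrite !mxE eqxx andbT ltnS leq_eqVlt val_eqE.
by case: eqVneq => [->|ik] /=; rewrite ?ltnn ?mulr1 ?mulr0 ?add0r ?addr0.
Qed.

Lemma mx_norm_leP (h : 'cV[R]_m) (e : R) : 0 <= e ->
  `|h| <= e <-> forall i, `|h i 0| <= e.
Proof.
move=> e0; split=> [he i|H].
  apply: le_trans he; rewrite [leRHS]/Num.Def.normr/= mx_normrE.
  exact: (le_bigmax _ (fun ij => `|h ij.1 ij.2|) (i, ord0)).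
rewrite /Num.Def.normr/= mx_normrE; apply: bigmax_le => // -[i j] _ /=.
by rewrite ord1.
Qed.

(** Go from y to h + y by changing one coordinate at a time; on each step the
    mean value theorem replaces the increment by a partial derivative at a point
    close to y. *)
Lemma C1_increment g y : (\forall z \near y, forall k, derivable g z (delta_mx k 0)) ->
  (forall k, {for y, continuous (partial k g)}) ->
  forall e, 0 < e -> \forall h \near (0 : 'cV[R]_m),
    `|g (h + y) - g y - \sum_k partial k g y * h k 0| <= e * `|h|.
Proof.
move=> dg cg e e0.
pose e' := e / m.+1%:R.
have e'0 : 0 < e' by rewrite divr_gt0.
have : \forall z \near y, (forall k, derivable g z (delta_mx k 0)) /\
    (forall k, `|partial k g y - partial k g z| <= e').
  near=> z; split; first by near: z.
  near: z; apply: filter_forall => k.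
  exact: ((cvgrPdist_le _ _).1 (cg k)).
move=> /nbhs_ballP[r r0 Hr].
apply/nbhs_ballP; exists (r / 2) => /=; first by rewrite divr_gt0.
move=> h; rewrite -ball_normE /= sub0r normrN => hr.
(* all intermediate points stay within r of y *)
have B (k : 'I_m) (s : R) : `|s| <= `|h k 0| ->
    ball y r (truncate k h + y + s *: delta_mx k 0).
  move=> sh; rewrite -ball_normE /= addrAC [_ + y]addrC opprD addrA subrr add0r.
  rewrite normrN.
  have : `|truncate k h + s *: delta_mx k 0| <= `|h|.
    apply/mx_norm_leP => // i; have := (mx_norm_leP h (normr_ge0 h)).1 (lexx _) i.
    rewrite !mxE eqxx andbT; case: (eqVneq i k) => [->|ik] /=.
      by rewrite ltnn add0r mulr1 => /(le_trans sh).
    rewrite mulr0 addr0; case: ifP => // _; by rewrite normr0.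
  move=> /le_lt_trans; apply; apply: lt_le_trans hr _.
  by rewrite ler_pdivrMr // ler_peMr ?ltW// ltr1n.
have E : g (h + y) - g y =
    \sum_(k < m) (g (truncate k.+1 h + y) - g (truncate k h + y)).
  rewrite -(big_mkord xpredT (fun k => g (truncate k.+1 h + y) - g (truncate k h + y))).
  by rewrite telescope_sumr // truncate_full truncate0 add0r.
rewrite E -sumrB; apply: le_trans (ler_norm_sum _ _ _) _.
have S (k : 'I_m) : `|g (truncate k.+1 h + y) - g (truncate k h + y)
     - partial k g y * h k 0| <= e' * `|h|.
  rewrite truncateS (addrAC (truncate k h)).
  have [|s sh ->] := @line_MVT R _ g (truncate k h + y) (delta_mx k 0) (h k 0).
    by move=> s /B /Hr [].
  rewrite mulrC -mulrBl normrM; apply: ler_pM => //.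
    rewrite distrC; exact: (Hr _ (B _ _ sh)).2.
  exact: (mx_norm_leP h (normr_ge0 h)).1.
apply: le_trans (ler_sum _ (fun k _ => S k)) _.
rewrite sumr_const card_ord -mulr_natl mulrA ler_wpM2r // /e' mulrCA.
by rewrite ler_piMr ?(ltW e0)// ler_pdivrMr ?ltr0n// mul1r ler_nat.
Unshelve. all: by end_near. Qed.

(** This makes the chain rule for total differentials available for functions of
    which only partial derivatives are known. *)
Lemma C1_differentiable g y :
  (\forall z \near y, forall k, derivable g z (delta_mx k 0)) ->
  (forall k, {for y, continuous (partial k g)}) -> differentiable g y.
Proof.
move=> dg cg; pose L h : R := \sum_k partial k g y * h k 0.
have Llin : linear L.
  move=> a u v; rewrite /L scaler_sumr -big_split; apply: eq_bigr => k _ /=.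
  by rewrite !mxE mulrDr /GRing.scale /= mulrCA.
pose LM := GRing.isLinear.Build _ _ _ _ _ Llin.
pose LL : {linear _ -> _} := HB.pack L LM.
have Lcont : continuous LL.
  apply: continuous_big; first exact: add_continuous.
  move=> k _ h.
  apply: (@continuousM R _ (fun=> partial k g y) (fun h : 'cV[R]_m => h k 0) h).
    by apply: cst_continuous.
  exact: coord_continuous.
have H : g \o shift y = cst (g y) + (LL : 'cV[R]_m -> R) +o_ (0 : 'cV[R]_m) id.
  apply/eqaddoP => e e0; have := C1_increment dg cg e0.
  by apply: filterS => h; rewrite -addrA -opprD.
by apply/diff_locallyP; rewrite (@diff_unique _ _ _ g LL y Lcont H).
Qed.

Lemma derive_curve g (c : R -> 'cV[R]_m) :
  differentiable g (c 0) -> (forall k, derivable (fun t => c t k 0) 0 1) ->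
  'D_1 (g \o c) 0 = \sum_k partial k g (c 0) * 'D_1 (fun t => c t k 0) 0.
Proof.
move=> dg dc.
have dc' : derivable c 0 1.
  by apply/derivable_mxP => i j; rewrite ord1.
have dcd : differentiable c 0 by apply/derivable1_diffP.
rewrite deriveE; last exact: differentiable_comp.
rewrite diff_comp //= -[X in 'd g _ X]deriveE // derive_mx //.
set w := \matrix_(i, j) _.
have -> : w = \sum_k w k 0 *: delta_mx k 0.
  by rewrite {1}(matrix_sum_delta w); apply: eq_bigr => k _; rewrite big_ord1.
rewrite linear_sum; apply: eq_bigr => k _; rewrite linearZ /= mulrC -deriveE //.
by rewrite mxE.
Qed.

End ContinuousPartials.

(** * The algebra of smooth functions and smooth matrices *)

Section Smooth.
Variables (R : realType) (m : nat).
Implicit Types (f g : 'cV[R]_m -> R) (V : set 'cV[R]_m).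

Lemma Ck_on_sub k V V' f : V' `<=` V -> Ck_on k V f -> Ck_on k V' f.
Proof.
move=> sV; elim: k f => [|k IH] f [cf H]; (split; first by move=> u /sV /cf) => // i.
by have [df Hf] := H i; split=> [u /sV /df //|]; exact: IH.
Qed.

Lemma Ck_on_pred k V f : Ck_on k.+1 V f -> Ck_on k V f.
Proof.
elim: k f => [|k IH] f [cf H]; split => // i.
by have [df Hf] := H i; split => //; exact: IH.
Qed.

Lemma eq_on_near V f g u : open V -> (forall u, V u -> f u = g u) -> V u ->
  {near u, f =1 g}.
Proof. by move=> oV fg Vu; apply: filterS (open_nbhs_nbhs (conj oV Vu)). Qed.

Lemma eq_continuous V f g u : open V -> (forall u, V u -> f u = g u) -> V u ->
  {for u, continuous f} -> {for u, continuous g}.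
Proof.
move=> oV fg Vu cf; rewrite /prop_for /continuous_at -fg //.
apply: cvg_trans cf; apply: (@near_eq_cvg _ _ (nbhs u)).
exact: (eq_on_near oV fg Vu).
Qed.

Lemma eq_partial V f g i : open V -> (forall u, V u -> f u = g u) ->
  forall u, V u -> partial i f u = partial i g u.
Proof. by move=> oV fg u Vu; apply: near_eq_derive; exact: (eq_on_near oV fg Vu). Qed.

(** Partial derivatives only depend on germs, so openness of V lets the equality
    propagate through the induction. *)
Lemma eq_Ck_on k V f g : open V -> (forall u, V u -> f u = g u) ->
  Ck_on k V f -> Ck_on k V g.
Proof.
move=> oV; elim: k f g => [|k IH] f g fg [cf H].
  by split=> // u Vu; exact: (eq_continuous oV fg Vu (cf u Vu)).
split=> [u Vu|i]; first exact: (eq_continuous oV fg Vu (cf u Vu)).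
have [df Hf] := H i; split=> [u Vu|].
  by apply: near_eq_derivable (df u Vu); exact: (eq_on_near oV fg Vu).
by apply: IH Hf; exact: eq_partial.
Qed.

Lemma Ck_on_cst k V (a : R) : Ck_on k V (fun=> a).
Proof.
elim: k a => [|k IH] a; split=> //; first by move=> u _; apply: cst_continuous.
  by move=> u _; apply: cst_continuous.
move=> i; split=> [u _|]; first exact: derivable_cst.
have -> : partial i (fun=> a) = fun=> 0.
  by apply/funext => u; exact: derive_cst.
exact: IH.
Qed.

Lemma Ck_on_add k V f g : open V ->
  Ck_on k V f -> Ck_on k V g -> Ck_on k V (fun u => f u + g u).
Proof.
move=> oV; elim: k f g => [|k IH] f g [cf H] [cg G].
  by split=> // u Vu; apply: (continuousD (cf u Vu) (cg u Vu)).
split=> [u Vu|i]; first by apply: (continuousD (cf u Vu) (cg u Vu)).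
have [df Hf] := H i; have [dg Hg] := G i; split=> [u Vu|].
  by apply: (derivableD (df u Vu) (dg u Vu)).
apply: eq_Ck_on (IH _ _ Hf Hg) => // u Vu.
exact/esym/(deriveD (df u Vu) (dg u Vu)).
Qed.

Lemma Ck_on_mul k V f g : open V ->
  Ck_on k V f -> Ck_on k V g -> Ck_on k V (fun u => f u * g u).
Proof.
move=> oV; elim: k f g => [|k IH] f g Cf Cg.
  by case: Cf Cg => cf _ [cg _]; split=> // u Vu; apply: (continuousM (cf u Vu) (cg u Vu)).
have [cf H] := Cf; have [cg G] := Cg.
split=> [u Vu|i]; first by apply: (continuousM (cf u Vu) (cg u Vu)).
have [df Hf] := H i; have [dg Hg] := G i; split=> [u Vu|].
  by apply: (derivableM (df u Vu) (dg u Vu)).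
have := Ck_on_add oV (IH _ _ (Ck_on_pred Cf) Hg) (IH _ _ (Ck_on_pred Cg) Hf).
by apply: eq_Ck_on => // u Vu; exact/esym/(deriveM (df u Vu) (dg u Vu)).
Qed.

(** The derivative of 1/f is - f^-2 f', so the class of order k suffices for 1/f
    to carry out the induction at order k + 1. *)
Lemma Ck_on_inv k V f : open V -> (forall u, V u -> f u != 0) ->
  Ck_on k V f -> Ck_on k V (fun u => (f u)^-1).
Proof.
move=> oV f0; elim: k => [|k IH] Cf; have [cf H] := Cf.
  by split=> // u Vu; apply: (continuousV (f0 u Vu) (cf u Vu)).
split=> [u Vu|i]; first by apply: (continuousV (f0 u Vu) (cf u Vu)).
have [df Hf] := H i; split=> [u Vu|].
  by apply: (derivableV (f0 u Vu) (df u Vu)).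
have Ck := IH (Ck_on_pred Cf).
have := Ck_on_mul oV (Ck_on_mul oV (Ck_on_mul oV (Ck_on_cst k V (-1)) Ck) Ck) Hf.
apply: eq_Ck_on => // u Vu; rewrite /partial (deriveV (f0 u Vu) (df u Vu)).
by rewrite mulN1r mulNr -invfM -expr2 scaleNr mulNr.
Qed.

Lemma smooth_on_sub V V' f : V' `<=` V -> smooth_on V f -> smooth_on V' f.
Proof. by move=> sV sf k; exact: Ck_on_sub (sf k). Qed.

Lemma eq_smooth_on V f g : open V -> (forall u, V u -> f u = g u) ->
  smooth_on V f -> smooth_on V g.
Proof. by move=> oV fg sf k; exact: eq_Ck_on (sf k). Qed.

Lemma smooth_on_cst V (a : R) : smooth_on V (fun=> a).
Proof. by move=> k; exact: Ck_on_cst. Qed.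

Lemma smooth_on_add V f g : open V ->
  smooth_on V f -> smooth_on V g -> smooth_on V (fun u => f u + g u).
Proof. by move=> oV sf sg k; exact: Ck_on_add. Qed.

Lemma smooth_on_mul V f g : open V ->
  smooth_on V f -> smooth_on V g -> smooth_on V (fun u => f u * g u).
Proof. by move=> oV sf sg k; exact: Ck_on_mul. Qed.

Lemma smooth_on_inv V f : open V -> (forall u, V u -> f u != 0) ->
  smooth_on V f -> smooth_on V (fun u => (f u)^-1).
Proof. by move=> oV f0 sf k; exact: Ck_on_inv. Qed.

Lemma smooth_on_opp V f : open V -> smooth_on V f -> smooth_on V (fun u => - f u).
Proof.
move=> oV sf; have := smooth_on_mul oV (smooth_on_cst V (-1)) sf.
by apply: eq_smooth_on => // u _; rewrite mulN1r.
Qed.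

Lemma smooth_on_sum (I : Type) (r : seq I) (P : pred I) V (F : I -> 'cV[R]_m -> R) :
  open V -> (forall i, smooth_on V (F i)) ->
  smooth_on V (fun u => \sum_(i <- r | P i) F i u).
Proof.
move=> oV sF; elim: r => [|i r IH].
  by apply: eq_smooth_on (smooth_on_cst V 0) => // u _; rewrite big_nil.
case Pi: (P i); last by apply: eq_smooth_on IH => // u _; rewrite big_cons Pi.
by apply: eq_smooth_on (smooth_on_add oV (sF i) IH) => // u _; rewrite big_cons Pi.
Qed.

Lemma smooth_on_prod (I : Type) (r : seq I) (P : pred I) V (F : I -> 'cV[R]_m -> R) :
  open V -> (forall i, smooth_on V (F i)) ->
  smooth_on V (fun u => \prod_(i <- r | P i) F i u).
Proof.
move=> oV sF; elim: r => [|i r IH].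
  by apply: eq_smooth_on (smooth_on_cst V 1) => // u _; rewrite big_nil.
case Pi: (P i); last by apply: eq_smooth_on IH => // u _; rewrite big_cons Pi.
by apply: eq_smooth_on (smooth_on_mul oV (sF i) IH) => // u _; rewrite big_cons Pi.
Qed.

Lemma smooth_on_derivable V f i u : smooth_on V f -> V u -> derivable f u (delta_mx i 0).
Proof. by move=> /(_ 1%N) [_ /(_ i) [H _]] /H. Qed.

Lemma smooth_on_continuous V f u : smooth_on V f -> V u -> {for u, continuous f}.
Proof. by move=> /(_ 0%N) [H _] /H. Qed.

Lemma smooth_on_partial V f i : smooth_on V f -> smooth_on V (partial i f).
Proof. by move=> sf k; have [_ /(_ i) []] := sf k.+1. Qed.

Lemma smooth_on_differentiable V f u : open V -> smooth_on V f -> V u ->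
  differentiable f u.
Proof.
move=> oV sf Vu; apply: C1_differentiable.
  apply: filterS (open_nbhs_nbhs (conj oV Vu)) => v Vv k.
  exact: smooth_on_derivable sf Vv.
by move=> k; exact: smooth_on_continuous (smooth_on_partial k sf) Vu.
Qed.

Lemma partial_cst (i : 'I_m) (a : R) u : partial i (fun=> a) u = 0.
Proof. exact: derive_cst. Qed.

Lemma partialN V (f : 'cV[R]_m -> R) i u : smooth_on V f -> V u ->
  partial i (fun v => - f v) u = - partial i f u.
Proof. by move=> sf Vu; rewrite /partial deriveN //; exact: smooth_on_derivable sf Vu. Qed.

Lemma partialD V (f g : 'cV[R]_m -> R) i u : smooth_on V f -> smooth_on V g -> V u ->
  partial i (fun v => f v + g v) u = partial i f u + partial i g u.
Proof.
move=> sf sg Vu; rewrite /partial deriveD //.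
  exact: smooth_on_derivable sf Vu.
exact: smooth_on_derivable sg Vu.
Qed.

Definition smooth_mx k l V (A : 'cV[R]_m -> 'M[R]_(k, l)) : Prop :=
  forall i j, smooth_on V (fun u => A u i j).

Section Matrix.
Variables (V : set 'cV[R]_m) (oV : open V).

Lemma eq_smooth_mx k l (A B : 'cV[R]_m -> 'M[R]_(k, l)) :
  (forall u, V u -> A u = B u) -> smooth_mx V A -> smooth_mx V B.
Proof.
by move=> AB sA i j; apply: eq_smooth_on (sA i j) => // u Vu; rewrite AB.
Qed.

Lemma smooth_mx_cst k l (A : 'M[R]_(k, l)) : smooth_mx V (fun=> A).
Proof. by move=> i j; exact: smooth_on_cst. Qed.

Lemma smooth_mx_add k l (A B : 'cV[R]_m -> 'M[R]_(k, l)) :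
  smooth_mx V A -> smooth_mx V B -> smooth_mx V (fun u => A u + B u).
Proof.
move=> sA sB i j; apply: eq_smooth_on (smooth_on_add oV (sA i j) (sB i j)) => // u _.
by rewrite mxE.
Qed.

Lemma smooth_mx_opp k l (A : 'cV[R]_m -> 'M[R]_(k, l)) :
  smooth_mx V A -> smooth_mx V (fun u => - A u).
Proof.
move=> sA i j; apply: eq_smooth_on (smooth_on_opp oV (sA i j)) => // u _.
by rewrite mxE.
Qed.

Lemma smooth_mx_scale k l f (A : 'cV[R]_m -> 'M[R]_(k, l)) :
  smooth_on V f -> smooth_mx V A -> smooth_mx V (fun u => f u *: A u).
Proof.
move=> sf sA i j; apply: eq_smooth_on (smooth_on_mul oV sf (sA i j)) => // u _.
by rewrite mxE.
Qed.

Lemma smooth_mx_mul k l p (A : 'cV[R]_m -> 'M[R]_(k, l)) (B : 'cV[R]_m -> 'M[R]_(l, p)) :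
  smooth_mx V A -> smooth_mx V B -> smooth_mx V (fun u => A u *m B u).
Proof.
move=> sA sB i j.
have := smooth_on_sum (index_enum 'I_l) xpredT oV
  (fun q => smooth_on_mul oV (sA i q) (sB q j)).
by apply: eq_smooth_on => // u _; rewrite mxE.
Qed.

Lemma smooth_on_det k (A : 'cV[R]_m -> 'M[R]_k) :
  smooth_mx V A -> smooth_on V (fun u => \det (A u)).
Proof.
move=> sA; apply: smooth_on_sum => // s; apply: smooth_on_mul => //.
  exact: smooth_on_cst.
by apply: smooth_on_prod => // i; exact: sA.
Qed.

(** By Cramer's formula. *)
Lemma smooth_mx_inv k (A : 'cV[R]_m -> 'M[R]_k) :
  (forall u, V u -> A u \in unitmx) ->
  smooth_mx V A -> smooth_mx V (fun u => invmx (A u)).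
Proof.
move=> uA sA.
have : smooth_mx V (fun u => (\det (A u))^-1 *: \adj (A u)).
  apply: smooth_mx_scale.
    apply: smooth_on_inv => //; last exact: smooth_on_det.
    by move=> u /uA; rewrite unitmxE unitfE.
  move=> i j.
  apply: (@eq_smooth_on _ (fun u => cofactor (A u) j i)) => // [u _|].
    by rewrite mxE.
  apply: smooth_on_mul => //; first exact: smooth_on_cst.
  apply: smooth_on_det => a b.
  by apply: eq_smooth_on (sA (lift j a) (lift i b)) => // u _; rewrite !mxE.
by apply: eq_smooth_mx => u /uA uAu; rewrite /invmx uAu.
Qed.

End Matrix.
End Smooth.

(** * Charts and Jacobians of transition maps *)

Section Charts.
Variables (R : realType) (m : nat) (M : smooth_manifold R m).
Implicit Types (c : chart M) (U : set M) (x : M).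

(** The open set of the coordinate space that represents the part of U visible in
    the chart c. *)
Definition readout c U : set 'cV[R]_m := crd c @` (dom c `&` U).

Lemma readout_crd c U x : U x -> dom c x -> readout c U (crd c x).
Proof. by move=> Ux cx; exists x. Qed.

Lemma readout_par c U u : readout c U u ->
  [/\ dom c (par c u), U (par c u) & crd c (par c u) = u].
Proof. by case=> x [cx Ux] <-; rewrite crdK. Qed.

Lemma open_readout c U : open U -> open (readout c U).
Proof.
move=> oU; rewrite openE => u Vu; have [cu Uu uK] := readout_par Vu.
have Du : (crd c @` dom c) u by exists (par c u).
have nD : nbhs u (crd c @` dom c).
  by apply: open_nbhs_nbhs; split=> //; exact: crd_open.
have nU : nbhs u (par c @^-1` U).
  by apply: (par_continuous Du); apply: open_nbhs_nbhs; split.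
apply: filterS (filterI nD nU) => _ [[x cx <-] Ux]; exists x => //; split=> //.
by move: Ux; rewrite /= crdK.
Qed.

(** The chain rule along the image in the chart c' of the j-th coordinate line of
    the chart c; reading this curve in c again gives back the coordinate line. *)
Lemma trans_mul c c' x : dom c x -> dom c' x ->
  trans c' c x *m trans c c' x = 1%:M.
Proof.
move=> cx c'x; apply/matrixP => i j; rewrite !mxE.
set y := crd c x; set e : 'cV[R]_m := delta_mx j 0.
pose g (v : 'cV[R]_m) := crd c (par c' v) i 0.
pose f k (u : 'cV[R]_m) := crd c' (par c u) k 0.
pose gam (t : R) := crd c' (par c (y + t *: e)).
have g0 : gam 0 = crd c' x by rewrite /gam scale0r addr0 crdK.
have oV : open (readout c (dom c')) by apply: open_readout; exact: dom_open.
have oV' : open (readout c' (dom c)) by apply: open_readout; exact: dom_open.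
have Vy : readout c (dom c') y by exact: readout_crd.
have V'x : readout c' (dom c) (crd c' x) by exact: readout_crd.
have df k : is_derive (0 : R) (1 : R) (fun t => gam t k 0) (partial j (f k) y).
  have dfk : derivable (f k) (y + (0 : R) *: e) e.
    rewrite scale0r addr0; apply: (@smooth_on_derivable _ _ (readout c (dom c'))) => //.
    exact: transition_smooth.
  by have := is_derive_line dfk; rewrite /partial scale0r addr0.
have dg : differentiable g (gam 0).
  rewrite g0; apply: (@smooth_on_differentiable _ _ (readout c' (dom c))) => //.
  exact: transition_smooth.
have dgam k : derivable (fun t => gam t k 0) (0 : R) (1 : R) by case: (df k).
have := derive_curve dg dgam; rewrite g0.
have -> : \sum_k partial k g (crd c' x) * 'D_1 (fun t => gam t k 0) 0 =
    \sum_k trans c' c x i k * trans c c' x k j.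
  by apply: eq_bigr => k _; rewrite !mxE; case: (df k) => _ ->.
move=> <-.
transitivity ('D_1 (fun t : R => y i 0 + t * e i 0) 0).
  apply: near_eq_derive.
  have : \forall t \near (0 : R), readout c (dom c') (y + t *: e).
    have C : {for (0 : R), continuous (fun t : R => y + t *: e)}.
      apply: continuousD; first by apply: cst_continuous.
      exact: scalel_continuous.
    by apply: C; rewrite scale0r addr0; exact: open_nbhs_nbhs (conj oV Vy).
  apply: filterS => t /readout_par[ct c't tK] /=.
  by rewrite /g /gam crdK // tK !mxE.
rewrite deriveD; last 2 first.
- exact: derivable_cst.
- by apply: derivableM; [exact: derivable_id|exact: derivable_cst].
rewrite derive_cst add0r deriveM; [|exact: derivable_id|exact: derivable_cst].
by rewrite derive_cst derive_id scaler0 add0r /GRing.scale/= mulr1 mxE eqxx andbT.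
Qed.

Lemma trans_unit c c' x : dom c x -> dom c' x -> trans c c' x \in unitmx.
Proof. by move=> cx c'x; case: (mulmx1_unit (trans_mul cx c'x)). Qed.

End Charts.

(** * Exterior algebra *)

Section ExteriorAlgebra.
Variables (R : realType) (N : nat).
Implicit Types (x y xi : 'cV[R[i]]_N) (r s : cform R N) (S : {set 'I_N}) (i j : 'I_N).

Lemma wedge1Dr x r s : wedge1 x (r + s) = wedge1 x r + wedge1 x s.
Proof.
apply/ffunP => S; rewrite !ffunE -big_split; apply: eq_bigr => i _ /=.
by rewrite !ffunE mulrDr.
Qed.

Lemma wedge1Zr x (a : R[i]) r : wedge1 x (a *: r) = a *: wedge1 x r.
Proof.
apply/ffunP => S; rewrite !ffunE scaler_sumr; apply: eq_bigr => i _ /=.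
by rewrite !ffunE mulrCA.
Qed.

Lemma wedge1_0r x : wedge1 x (0 : cform R N) = 0.
Proof. by have := wedge1Zr x 0 0; rewrite !scale0r. Qed.

Lemma wedge1Nr x r : wedge1 x (- r) = - wedge1 x r.
Proof. by rewrite -scaleN1r wedge1Zr scaleN1r. Qed.

Lemma wedge1_sumr x (I : Type) (l : seq I) (P : pred I) (F : I -> cform R N) :
  wedge1 x (\sum_(k <- l | P k) F k) = \sum_(k <- l | P k) wedge1 x (F k).
Proof. by elim/big_rec2: _ => [|i y1 y2 _ <-]; rewrite ?wedge1_0r ?wedge1Dr. Qed.

Lemma wedge1Dl x y r : wedge1 (x + y) r = wedge1 x r + wedge1 y r.
Proof.
apply/ffunP => S; rewrite !ffunE -big_split; apply: eq_bigr => i _ /=.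
by rewrite !mxE mulrDr mulrDl.
Qed.

Lemma wedge1Zl (a : R[i]) x r : wedge1 (a *: x) r = a *: wedge1 x r.
Proof.
apply/ffunP => S; rewrite !ffunE scaler_sumr; apply: eq_bigr => i _ /=.
by rewrite !mxE mulrCA -!mulrA.
Qed.

Lemma wedge1_0l r : wedge1 0 r = 0.
Proof. by have := wedge1Zl 0 0 r; rewrite !scale0r. Qed.

Lemma wedge1_suml r (I : Type) (l : seq I) (P : pred I) (F : I -> 'cV[R[i]]_N) :
  wedge1 (\sum_(k <- l | P k) F k) r = \sum_(k <- l | P k) wedge1 (F k) r.
Proof. by elim/big_rec2: _ => [|i y1 y2 _ <-]; rewrite ?wedge1_0l ?wedge1Dl. Qed.

Lemma nbelowD1 i j S : i \in S -> nbelow j S = ((i < j) + nbelow j (S :\ i))%N.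
Proof.
move=> iS; rewrite /nbelow (cardsD1 i) inE iS /=; congr (_ + #|pred_of_set _|)%N.
by apply/setP => k; rewrite !inE andbA.
Qed.

(** For i <> j in S, removing i and then j or j and then i differs by one
    transposition: exactly one of i < j and j < i changes the count of smaller
    elements. *)
Lemma wedge1_anticomm x y r : wedge1 x (wedge1 y r) = - wedge1 y (wedge1 x r).
Proof.
apply/ffunP => S; rewrite !ffunE.
pose T x y i j : R[i] := (-1) ^+ (nbelow i S + nbelow j (S :\ i))
  * x i 0 * y j 0 * r (S :\ i :\ j)%SET.
have E (u v : 'cV[R[i]]_N) : \sum_(i in S) (-1) ^+ nbelow i S * u i 0 * wedge1 v r (S :\ i)%SET
    = \sum_i \sum_j if [&& i \in S, j \in S & i != j] then T u v i j else 0.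
  rewrite big_mkcond; apply: eq_bigr => i _; case iS: (i \in S) => /=.
    rewrite ffunE mulr_sumr big_mkcond; apply: eq_bigr => j _.
    rewrite in_setD1 eq_sym andbC; case: ifP => // _.
    by rewrite /T exprD; ring.
  by rewrite big1.
rewrite (E x y) (E y x) exchange_big -sumrN; apply: eq_bigr => i _ /=.
rewrite -sumrN; apply: eq_bigr => j _ /=.
rewrite andbCA eq_sym; case: ifP => [/and3P[iS jS ij]|_]; last by rewrite oppr0.
rewrite /T (nbelowD1 _ iS) (nbelowD1 _ jS) finset.setDDl finset.setUC -finset.setDDl.
move: ij; case: ltngtP => [ij|ij|/val_inj ->]; rewrite ?eqxx // => _;
  rewrite !exprD /= !expr1 !expr0; ring.
Qed.

Lemma wedge1_square x r : wedge1 x (wedge1 x r) = 0.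
Proof.
apply/eqP; have := wedge1_anticomm x x r => /eqP.
rewrite -subr_eq0 opprK -mulr2n -scaler_nat scaler_eq0.
by rewrite pnatr_eq0.
Qed.

Lemma wedge1_wedge2 x (B : 'M[R[i]]_N) r :
  wedge1 x (wedge2 B r) = wedge2 B (wedge1 x r).
Proof.
rewrite /wedge2 wedge1Zr wedge1_sumr; congr (_ *: _); apply: eq_bigr => i _.
rewrite wedge1_sumr; apply: eq_bigr => j _; rewrite wedge1Zr; congr (_ *: _).
by rewrite wedge1_anticomm (wedge1_anticomm x) wedge1Nr opprK.
Qed.

Lemma wedge2_0 (B : 'M[R[i]]_N) : wedge2 B (0 : cform R N) = 0.
Proof.
by rewrite /wedge2 big1 ?scaler0 // => i _; rewrite big1 // => j _; rewrite !wedge1_0r scaler0.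
Qed.

Lemma wedge1_exp_wedge x (B : 'M[R[i]]_N) r :
  wedge1 x r = 0 -> wedge1 x (exp_wedge B r) = 0.
Proof.
move=> xr; rewrite /exp_wedge wedge1_sumr big1 // => k _; rewrite wedge1Zr.
have -> : wedge1 x (iter k (wedge2 B) r) = iter k (wedge2 B) (wedge1 x r).
  by elim: (k : nat) => //= l <-; rewrite wedge1_wedge2.
have -> : iter k (wedge2 B) (wedge1 x r) = 0.
  by rewrite xr; elim: (k : nat) => //= l ->; rewrite wedge2_0.
by rewrite scaler0.
Qed.

Lemma wedge1_decomposable x (th : seq 'cV[R[i]]_N) :
  x \in th -> wedge1 x (decomposable th) = 0.
Proof.
elim: th => // y th IH; rewrite inE => /predU1P[->|/IH xth] /=.
  by rewrite wedge1_square.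
by rewrite wedge1_anticomm xth wedge1_0r oppr0.
Qed.

(** A covector in the span of the remaining ones annihilates their product. *)
Lemma decomposable_free (th : seq 'cV[R[i]]_N) :
  decomposable th != 0 -> free th.
Proof.
elim: th => [_|x th IH] /=; first exact: nil_free.
move=> xth0; rewrite free_cons IH ?andbT; last first.
  by apply: contraNneq xth0 => ->; rewrite wedge1_0r.
apply: contraNN xth0 => /(coord_span (X := in_tuple th)) ->.
rewrite wedge1_suml big1 // => i _; rewrite wedge1Zl wedge1_decomposable ?scaler0 //.
by rewrite mem_nth.
Qed.

(** The filtration by lowest degree: exp_wedge B r and r agree in the lowest
    degrees, since every further term of the series is raised by at least 2. *)
Definition vanishes_below (d : nat) r := forall S, (#|S| < d)%N -> r S = 0.

Lemma vanishes_below_wedge1 d x r :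
  vanishes_below d r -> vanishes_below d.+1 (wedge1 x r).
Proof.
move=> rd S Sd; rewrite ffunE big1 // => i iS; rewrite rd ?mulr0 //.
by move: Sd; rewrite (cardsD1 i) iS.
Qed.

Lemma vanishes_below_wedge2 d (B : 'M[R[i]]_N) r :
  vanishes_below d r -> vanishes_below d.+2 (wedge2 B r).
Proof.
move=> rd S Sd; rewrite /wedge2 !ffunE sum_ffunE big1 ?scaler0 // => i _.
rewrite sum_ffunE big1 // => j _; rewrite ffunE.
have W := vanishes_below_wedge1 (delta_mx i 0) (vanishes_below_wedge1 (delta_mx j 0) rd).
by rewrite W ?scaler0.
Qed.

Lemma exp_wedge_lowest d (B : 'M[R[i]]_N) r S :
  vanishes_below d r -> (#|S| < d.+2)%N -> exp_wedge B r S = r S.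
Proof.
move=> rd Sd; rewrite /exp_wedge sum_ffunE big_ord_recl /= ffunE.
rewrite invr1 scale1r big1 ?addr0 // => k _; rewrite ffunE.
suff H l : vanishes_below (d + l.*2) (iter l (wedge2 B) r).
  by rewrite (vanishes_below_wedge2 B (H k)) ?scaler0 // (leq_trans Sd) // !ltnS leq_addr.
elim: l => [|l IH]; first by rewrite addn0.
by rewrite doubleS !addnS; exact: vanishes_below_wedge2.
Qed.

Lemma decomposable1_set1 x i : decomposable [:: x] [set i]%SET = x i 0.
Proof.
rewrite /= ffunE big_set1 ffunE finset.setDv eqxx mulr1 /nbelow.
rewrite (_ : [set j in _ | _]%SET = finset.set0) ?cards0 ?mul1r //.
by apply/setP => j; rewrite !inE; case: eqVneq => // ->; rewrite ltnn.
Qed.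

(** In degree 2 the product x /\ exp(B) y is just x /\ y, whose coefficients are
    the 2 x 2 minors of x and y. *)
Lemma wedge1_exp_decomposable1 x y (B : 'M[R[i]]_N) :
  wedge1 x (exp_wedge B (decomposable [:: y])) = 0 ->
  forall i j, x i 0 * y j 0 = x j 0 * y i 0.
Proof.
move=> xy; have W i j : (i < j)%N -> x i 0 * y j 0 = x j 0 * y i 0.
  move=> ij; have ji : j != i by rewrite -val_eqE gtn_eqF.
  (* the coefficient at {i, j} is x i * y j - x j * y i *)
  move/ffunP/(_ [set i; j]%SET): xy; rewrite !ffunE.
  have vd : vanishes_below 1 (decomposable [:: y]).
    by apply: vanishes_below_wedge1 => S.
  rewrite big_setU1 ?inE 1?eq_sym //= big_set1.
  have -> : ([set i; j] :\ i = [set j])%SET.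
    by apply/setP => k; rewrite !inE; case: eqVneq => //= ->; rewrite eq_sym (negPf ji).
  have -> : ([set i; j] :\ j = [set i])%SET.
    by apply/setP => k; rewrite !inE; case: (eqVneq k j) => //= [->|]; rewrite ?(negPf ji) ?orbF.
  rewrite !(exp_wedge_lowest _ vd) ?cards1 // !decomposable1_set1.
  have -> : nbelow i [set i; j]%SET = 0%N.
    apply/eqP; rewrite cards_eq0; apply/eqP/setP => k; rewrite !inE.
    by apply/negP => /andP[/orP[]/eqP-> ]; rewrite ?ltnn // ltnNge ltnW.
  have -> : nbelow j [set i; j]%SET = 1%N.
    rewrite /nbelow (_ : [set k in _ | _]%SET = [set i]%SET) ?cards1 //.
    apply/setP => k; rewrite !inE; case: (eqVneq k i) => [->|ki] /=; first by rewrite ij.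
    by case: eqVneq => // ->; rewrite ltnn.
  rewrite expr0 expr1 => /eqP; rewrite mul1r mulN1r mulNr subr_eq0 => /eqP.
  by [].
move=> i j; case: (ltngtP i j) => [/W //|/W //|/val_inj ->//].
Qed.

End ExteriorAlgebra.

(** * From the type to the bivector *)

Lemma complex_ext (R : rcfType) (x y : R[i]) :
  complex.Re x = complex.Re y -> complex.Im x = complex.Im y -> x = y.
Proof. by case: x y => [a b] [c d] /= -> ->. Qed.

Section Types.
Variable R : realType.

Lemma toC_mul k l p (A : 'M[R]_(k, l)) (B : 'M[R]_(l, p)) : toC (A *m B) = toC A *m toC B.
Proof. exact: map_mxM. Qed.

Lemma toC_inj k l : injective (@toC R k l).
Proof. by move=> A B /matrixP AB; apply/matrixP => i j; have := AB i j; rewrite !mxE => -[]. Qed.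

Lemma toC_col0 N (E : 'M[R]_(N + N)) (xi : 'cV[R[i]]_N) :
  toC E *m col_mx 0 xi = col_mx (toC (ursubmx E) *m xi) (toC (drsubmx E) *m xi).
Proof.
rewrite -{1}[E]submxK /toC map_block_mx mul_block_col !mulmx0 !add0r.
by rewrite !map_ursubmx !map_drsubmx.
Qed.

(** Covectors in the i-eigenspace, that is, elements of the intersection of L
    with the complexified cotangent space. *)
Definition form_eigen N (E : 'M[R]_(N + N)) (xi : 'cV[R[i]]_N) :=
  toC E *m col_mx 0 xi = 'i%C *: col_mx 0 xi.

Lemma form_eigenP N (E : 'M[R]_(N + N)) (xi : 'cV[R[i]]_N) :
  form_eigen E xi <->
  toC (ursubmx E) *m xi = 0 /\ toC (drsubmx E) *m xi = 'i%C *: xi.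
Proof.
rewrite /form_eigen toC_col0 scale_col_mx scaler0; split=> [/eq_col_mx //|[-> ->] //].
Qed.

Lemma clifford_col0 N (xi : 'cV[R[i]]_N) (r : cform R N) :
  clifford (col_mx 0 xi) r = wedge1 xi r.
Proof.
rewrite /clifford col_mxKu col_mxKd (_ : interior_mul _ _ = 0) ?add0r //.
by apply/ffunP => S; rewrite !ffunE big1 // => i _; rewrite mxE mulr0 mul0r.
Qed.

(** The factors of the decomposable part are killed by the Clifford action, because
    wedging with them commutes with exp(B + i w). *)
Lemma has_type_forms N (E : 'M[R]_(N + N)) k : has_type E k ->
  exists th : k.-tuple 'cV[R[i]]_N, free th /\ forall xi, xi \in th -> form_eigen E xi.
Proof.
case=> [B [w [th [_ _ th0 H]]]]; exists th; split; first exact: decomposable_free.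
move=> xi xith; apply/H; rewrite clifford_col0.
exact/wedge1_exp_wedge/wedge1_decomposable.
Qed.

(** The factors of the spinor are eigencovectors for i, their conjugates for - i;
    together they are a basis of the complexified cotangent space, so the latter
    is invariant. *)
Lemma has_type_half N (E : 'M[R]_(N + N)) k : N = (k + k)%N ->
  has_type E k -> ursubmx E = 0.
Proof.
move=> eN; move: E; rewrite eN => E /has_type_forms[th [fth Eth]].
pose T : 'M[R[i]]_(k, k + k) := \matrix_(i, j) tnth th i j 0.
have rowT i : row i T = (tnth th i)^T by apply/rowP => j; rewrite !mxE.
have mulT (A : 'M[R[i]]_(k + k)) i : row i (T *m A^T) = (A *m tnth th i)^T.
  by rewrite row_mul rowT trmx_mul.
pose D := toC (drsubmx E); pose P := toC (ursubmx E).
have TP : T *m P^T = 0.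
  apply/row_matrixP => i; rewrite mulT row0.
  by have /form_eigenP[-> _] := Eth _ (mem_tnth i th); rewrite trmx0.
have TD : T *m D^T = 'i%C *: T.
  apply/row_matrixP => i; rewrite mulT linearZ /= rowT.
  by have /form_eigenP[_ ->] := Eth _ (mem_tnth i th); rewrite linearZ.
have freeT (v : 'rV[R[i]]_k) : v *m T = 0 -> v = 0.
  move=> vT; apply/rowP => i; rewrite mxE.
  move/freeP: fth => /(_ (fun j => v 0 j)); apply.
  apply/colP => j; transitivity ((v *m T) 0 j); last by rewrite vT !mxE.
  rewrite summxE mxE; apply: eq_bigr => l _; rewrite !mxE (tnth_nth 0); ring.
have conj_toC a b (A : 'M[R]_(a, b)) : map_mx (@conjc R) (toC A) = toC A.
  by apply/matrixP => i j; rewrite !mxE conjc_real.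
pose T' := map_mx (@conjc R) T.
have T'P : T' *m P^T = 0.
  by rewrite -[P]conj_toC -/P map_trmx -map_mxM TP map_mx0.
have T'D : T' *m D^T = - 'i%C *: T'.
  rewrite -[D]conj_toC -/D map_trmx -map_mxM TD map_mxZ.
  by congr (_ *: _); apply/eqP; rewrite eq_complex /= oppr0 !eqxx.
have freeT' (v : 'rV[R[i]]_k) : v *m T' = 0 -> v = 0.
  move=> vT'; have : map_mx (@conjc R) (map_mx (@conjc R) v *m T) = 0.
    rewrite map_mxM -/T'; rewrite (_ : map_mx _ (map_mx _ v) = v) //.
    by apply/matrixP => i j; rewrite !mxE; exact: conjcK.
  move=> /eqP; rewrite map_mx_eq0 => /eqP/freeT/eqP.
  by rewrite map_mx_eq0 => /eqP.
(* multiplying a relation by D separates the two eigenspaces *)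
have freeTT : row_free (col_mx T T').
  apply: inj_row_free => v; rewrite -[v]hsubmxK mul_row_col.
  set v1 := lsubmx v; set v2 := rsubmx v => S.
  have S' : v1 *m T - v2 *m T' = 0.
    have := congr1 (mulmx^~ D^T) S; rewrite mulmxDl -!mulmxA TD T'D mul0mx.
    rewrite -!scalemxAr scaleNr -scalerBr => /eqP; rewrite scaler_eq0.
    by rewrite (_ : 'i%C == 0 = false) ?eq_complex /= ?oner_eq0 ?andbF // => /eqP.
  have S1 : v1 *m T = 0.
    apply/eqP; have /eqP := congr2 +%R S S'; rewrite addrACA subrr !addr0.
    by rewrite -mulr2n -scaler_nat scaler_eq0 pnatr_eq0.
  move: S; rewrite S1 add0r => /freeT' ->; rewrite (freeT _ S1).
  by rewrite row_mx0.
have : col_mx T T' *m P^T = 0 by rewrite mul_col_mx TP T'P col_mx0.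
rewrite row_free_unit in freeTT => /(congr1 (mulmx (invmx (col_mx T T')))).
rewrite mulKmx // mulmx0 => /(congr1 trmx); rewrite trmxK trmx0 => P0.
by apply: toC_inj; rewrite -/P P0 /toC map_mx0.
Qed.

(** Proportionality to th is stated through minors. *)
Lemma has_type1_forms N (E : 'M[R]_(N + N)) : has_type E 1 ->
  exists2 th : 'cV[R[i]]_N, th != 0 &
    forall xi, form_eigen E xi -> forall a b, xi a 0 * th b 0 = xi b 0 * th a 0.
Proof.
case=> [B [w [th [_ _ th0 H]]]]; case/tupleP: th th0 H => x th; rewrite tuple0 /= => th0 H.
exists x; first by apply: contraNneq th0 => ->; rewrite wedge1_0l.
by move=> xi /H; rewrite clifford_col0 => /wedge1_exp_decomposable1.
Qed.

Lemma twistor_ursubmx m (E : 'M[R]_(m + m)) :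
  ursubmx (twistor_mx E) = block_mx (ursubmx E) 0 0 0.
Proof. by rewrite /twistor_mx block_mxKur. Qed.

Lemma twistor_drsubmx m (E : 'M[R]_(m + m)) :
  drsubmx (twistor_mx E) = block_mx (drsubmx E) 0 0 (j_mx R)^T.
Proof. by rewrite /twistor_mx block_mxKdr. Qed.

Lemma twistor_type_half n (E : 'M[R]_(4 * n + 4 * n)) :
  has_type (twistor_mx E) (2 * n + 1) -> ursubmx E = 0.
Proof.
have eN : (4 * n + 2 = (2 * n + 1) + (2 * n + 1))%N by lia.
by move=> /(has_type_half eN); rewrite twistor_ursubmx -block_mx0 => /eq_block_mx[].
Qed.

(** If P has a real kernel vector x, then x - i D x is an i-eigencovector on the
    M side, since ker P is stable under the lower right block D with D^2 = - 1
    there.  It is not proportional to the eigencovector (1, i) of the sphere. *)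
Lemma twistor_type1 m (E : 'M[R]_(m + m)) : E *m E = - 1%:M ->
  has_type (twistor_mx E) 1 -> ursubmx E \in unitmx.
Proof.
move=> EE /has_type1_forms[th th0 H].
set P := ursubmx E; set D := drsubmx E.
have [PD DD] : ulsubmx E *m P + P *m D = 0 /\ dlsubmx E *m P + D *m D = - 1%:M.
  move: EE; rewrite -{1 2}[E]submxK mulmx_block scalar_mx_block.
  by rewrite opp_block_mx !oppr0 => /eq_block_mx[_ -> _ ->].
rewrite -unitmx_tr -row_free_unit; apply: inj_row_free => v vP.
pose x := v^T; have Px : P *m x = 0 by rewrite -[P]trmxK -trmx_mul vP trmx0.
have PDx : P *m (D *m x) = 0.
  move: PD => /(congr1 (mulmx^~ x)); rewrite mulmxDl -!mulmxA Px mulmx0 add0r.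
  by rewrite mul0mx.
have DDx : D *m (D *m x) = - x.
  move: DD => /(congr1 (mulmx^~ x)); rewrite mulmxDl -!mulmxA Px mulmx0 add0r.
  by rewrite mulNmx mul1mx.
pose eta : 'cV[R[i]]_m := toC x - 'i%C *: toC (D *m x).
have ii : 'i%C * 'i%C = -1 :> R[i] by rewrite -expr2 sqr_i.
have e1 : form_eigen (twistor_mx E) (col_mx eta 0).
  apply/form_eigenP; rewrite twistor_ursubmx twistor_drsubmx /toC !map_block_mx.
  rewrite !mul_block_col !mulmx0 !map_mx0 !mul0mx !addr0 scale_col_mx scaler0.
  rewrite -/(toC P) -/(toC D) /eta !mulmxBr -!scalemxAr -!toC_mul -/P -/D Px PDx DDx.
  split; first by rewrite /toC map_mx0 scaler0 subr0 col_mx0.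
  congr col_mx; rewrite scalerBr scalerA ii scaleN1r opprK.
  by rewrite /toC map_mxN scalerN opprK addrC.
pose z : 'cV[R[i]]_2 := \col_i (if i == 0 then 1 else 'i%C).
have e2 : form_eigen (twistor_mx E) (col_mx 0 z).
  apply/form_eigenP; rewrite twistor_ursubmx twistor_drsubmx /toC !map_block_mx.
  rewrite !mul_block_col !mulmx0 !map_mx0 !mul0mx !add0r col_mx0 scale_col_mx scaler0.
  split=> //; congr col_mx; apply/colP => i; rewrite !mxE big_ord_recl big_ord1 !mxE.
  case: i => [[|[|//]] ?] /=; rewrite ?rmorph0 ?rmorph1 ?rmorphN1 ?mul0r ?mul1r ?add0r ?mulr1 ?addr0 //.
(* e2 has no component on the M side, e1 has none on the sphere *)
have th1 i : th (lshift 2 i) 0 = 0.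
  have := H _ e2 (lshift 2 i) (rshift m 0).
  by rewrite col_mxEu col_mxEd !mxE mul0r mul1r.
have x0 i : x i 0 = 0.
  apply/eqP; apply: contraNT th0 => xi0; apply/eqP/colP => j; rewrite [RHS]mxE.
  have := H _ e1 (lshift 2 i) j; rewrite th1 mulr0 col_mxEu => /eqP.
  rewrite mulf_eq0 => /orP[|/eqP //] /eqP /(congr1 (@complex.Re R)).
  rewrite !mxE /= => E0; case/eqP: xi0; rewrite !mxE -[RHS]E0; ring.
by apply/rowP => i; have := x0 i; rewrite !mxE.
Qed.

End Types.

(** * Pointwise structure of generalized almost complex structures *)

Section MatrixFacts.
Variable R : realType.

Lemma scalar1_inj k (p q : R) : (0 < k)%N -> p *: 1%:M = q *: 1%:M :> 'M[R]_k -> p = q.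
Proof.
by move=> k0 /matrixP/(_ (Ordinal k0) (Ordinal k0)); rewrite !mxE eqxx !mulr1.
Qed.

Lemma mx0_eq k l (A B : 'M[R]_(k, l)) : k = 0%N -> A = B.
Proof. by move=> k0; subst k; apply/matrixP => -[]. Qed.

Lemma mx_pos_unit (k : nat) (A : 'M[R]_k) : (0 < k)%N -> A \in unitmx -> A != 0.
Proof.
case: k A => // k A _ uA; apply: contraTneq uA => ->.
by rewrite unitmxE det0 unitr0.
Qed.

(** det (P + s Q) is a polynomial in s that does not vanish at 0, so some
    positive integer is not a root. *)
Lemma generic_pencil_unit k (P Q : 'M[R]_k) : P \in unitmx ->
  exists2 s : R, s != 0 & P + s *: Q \in unitmx.
Proof.
move=> uP; pose p : {poly R} := \det (map_mx polyC P + 'X *: map_mx polyC Q).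
have pE s : p.[s] = \det (P + s *: Q).
  rewrite -[p.[s]]/(horner_eval s p) -det_map_mx; congr (\det _).
  apply/matrixP => i j; rewrite !mxE.
  by rewrite -[LHS]/(((P i j)%:P + 'X * (Q i j)%:P).[s]) !hornerE.
have p0 : p != 0.
  apply: contraTneq uP => p0; rewrite unitmxE unitfE -[P]addr0 -(scale0r Q) -pE p0.
  by rewrite horner0 eqxx.
pose rs : seq R := [seq (i.+1)%:R | i <- iota 0 (size p)].
have : ~~ all (root p) rs.
  have ur : uniq rs.
    rewrite map_inj_uniq ?iota_uniq // => i j /eqP.
    by rewrite eqr_nat eqSS => /eqP.
  apply/negP => ar; have := max_poly_roots p0 ar ur.
  by rewrite size_map size_iota ltnn.
case/allPn => _ /mapP[i _ ->]; rewrite /root pE => H; exists (i.+1)%:R.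
  by rewrite pnatr_eq0.
by rewrite unitmxE unitfE.
Qed.

End MatrixFacts.

Section AdExp.
Variables (R : realType) (m : nat).
Implicit Types (B w J P : 'M[R]_m) (E F : 'M[R]_(m + m)).

(** exp(B) acting on TM + T*M. *)
Definition shear B : 'M[R]_(m + m) := block_mx 1%:M 0 B 1%:M.

Definition Ad_mx B E := shear B *m E *m shear (- B).

Lemma shearM B B' : shear B *m shear B' = shear (B + B').
Proof.
by rewrite /shear mulmx_block !mul1mx !mulmx1 !mul0mx !mulmx0 !addr0 !add0r addrC.
Qed.

Lemma shear0 : shear 0 = 1%:M.
Proof. by rewrite /shear -scalar_mx_block. Qed.

Lemma Ad_mxM B E F : Ad_mx B (E *m F) = Ad_mx B E *m Ad_mx B F.
Proof.
rewrite /Ad_mx !mulmxA; congr (_ *m _ *m _).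
by rewrite -[LHS]mulmx1 -shear0 -(addNr B) -shearM !mulmxA.
Qed.

Lemma Ad_mxK B : cancel (Ad_mx B) (Ad_mx (- B)).
Proof.
move=> E; rewrite /Ad_mx opprK !mulmxA shearM addNr shear0 mul1mx -mulmxA shearM.
by rewrite addNr shear0 mulmx1.
Qed.

Lemma Ad_mx_comp B B' (E : 'M[R]_(m + m)) : Ad_mx B (Ad_mx B' E) = Ad_mx (B + B') E.
Proof. by rewrite /Ad_mx !mulmxA shearM -!mulmxA shearM opprD [- B' - B]addrC. Qed.

Lemma Ad_mx_inj B : injective (Ad_mx B).
Proof. exact: can_inj (Ad_mxK B). Qed.

Lemma Ad_mxD B E F : Ad_mx B (E + F) = Ad_mx B E + Ad_mx B F.
Proof. by rewrite /Ad_mx mulmxDr mulmxDl. Qed.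

Lemma Ad_mxN B E : Ad_mx B (- E) = - Ad_mx B E.
Proof. by rewrite /Ad_mx mulmxN mulNmx. Qed.

Lemma Ad_mxZ B a E : Ad_mx B (a *: E) = a *: Ad_mx B E.
Proof. by rewrite /Ad_mx -scalemxAr -scalemxAl. Qed.

Lemma Ad_mx1 B : Ad_mx B 1%:M = 1%:M.
Proof. by rewrite /Ad_mx mulmx1 shearM subrr shear0. Qed.

Lemma Ad_mx_block B (a b c d : 'M[R]_m) :
  Ad_mx B (block_mx a b c d) =
  block_mx (a - b *m B) b (B *m a + c - (B *m b + d) *m B) (B *m b + d).
Proof.
by rewrite /Ad_mx /shear !mulmx_block !mul1mx !mulmx1 !mul0mx !mulmx0 !addr0 !add0r !mulmxN.
Qed.

Lemma Ad_mx_ur B E : ursubmx (Ad_mx B E) = ursubmx E.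
Proof. by rewrite -[E]submxK Ad_mx_block !block_mxKur. Qed.

Definition symp_mx w : 'M[R]_(m + m) := block_mx 0 (- invmx w) w 0.

Definition cplx_mx J : 'M[R]_(m + m) := block_mx J 0 0 (- J^T).

Lemma Ad_symp_mx B w : Ad_mx B (symp_mx w) =
  block_mx (invmx w *m B) (- invmx w) (w + B *m invmx w *m B) (- (B *m invmx w)).
Proof.
by rewrite Ad_mx_block mulmx0 !addr0 !add0r mulmxN !mulNmx !opprK.
Qed.

Lemma Ad_cplx_mx B J :
  Ad_mx B (cplx_mx J) = block_mx J 0 (B *m J + J^T *m B) (- J^T).
Proof.
by rewrite Ad_mx_block mul0mx !mulmx0 subr0 addr0 add0r mulNmx opprK.
Qed.

Lemma symp_mx_square w : w \in unitmx -> symp_mx w *m symp_mx w = - 1%:M.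
Proof.
move=> uw; rewrite /symp_mx mulmx_block !mulmx0 !mul0mx !addr0 !add0r mulNmx mulmxN.
by rewrite mulVmx // mulmxV // scalar_mx_block opp_block_mx oppr0.
Qed.

(** An orthogonal E with E^2 = - 1 is skew for the pairing. *)
Lemma orthogonal_blocks E : E^T *m pairing_mx R m *m E = pairing_mx R m ->
  E *m E = - 1%:M ->
  [/\ drsubmx E = - (ulsubmx E)^T, (ursubmx E)^T = - ursubmx E &
      (dlsubmx E)^T = - dlsubmx E].
Proof.
move=> EQE EE; have QE : pairing_mx R m *m E + E^T *m pairing_mx R m = 0.
  by rewrite -{1}EQE -!mulmxA EE !mulmxN mulmx1 addNr.
move: QE; rewrite -[E]submxK; set A := ulsubmx E; set P := ursubmx E.
set S := dlsubmx E; set D := drsubmx E.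
rewrite !block_mxKul !block_mxKur !block_mxKdl !block_mxKdr tr_block_mx.
rewrite /pairing_mx !mulmx_block !mul0mx !mulmx0 !add0r !addr0.
rewrite !mul_scalar_mx !mul_mx_scalar add_block_mx -[RHS]block_mx0.
have half (X Y : 'M[R]_m) : 2%:R^-1 *: X + 2%:R^-1 *: Y = 0 -> X = - Y.
  move/eqP; rewrite -scalerDr scaler_eq0 invr_eq0 pnatr_eq0 /= addr_eq0.
  by move/eqP.
move=> /eq_block_mx[H1 H2 _ H4]; split; first exact: half.
  by rewrite [in RHS](half _ _ H4) opprK.
by rewrite [in RHS](half _ _ H1) opprK.
Qed.

Lemma square_blocks E : E *m E = - 1%:M -> drsubmx E = - (ulsubmx E)^T ->
  [/\ ulsubmx E *m ulsubmx E + ursubmx E *m dlsubmx E = - 1%:M,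
      ulsubmx E *m ursubmx E = ursubmx E *m (ulsubmx E)^T &
      dlsubmx E *m ulsubmx E = (ulsubmx E)^T *m dlsubmx E].
Proof.
rewrite -{1 2}[E]submxK mulmx_block scalar_mx_block opp_block_mx !oppr0.
move=> /eq_block_mx[-> H1 H2 _] HD; move: H1 H2; rewrite HD mulmxN mulNmx.
by move=> /eqP; rewrite subr_eq0 => /eqP -> /eqP; rewrite subr_eq0 => /eqP ->.
Qed.

(** When its bivector is invertible, E is the B_part-transform of the structure of
    symp_part (symp_normal_form). *)
Definition symp_part E : 'M[R]_m := - invmx (ursubmx E).

Definition B_part E : 'M[R]_m := symp_part E *m ulsubmx E.

Lemma unitmxN (X : 'M[R]_m) : (- X \in unitmx) = (X \in unitmx).
Proof. by rewrite -scaleN1r unitmxZ // unitrN1. Qed.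

Lemma invmxN (X : 'M[R]_m) : invmx (- X) = - invmx X.
Proof.
have [uX|nX] := boolP (X \in unitmx); last by rewrite /invmx unitmxN (negPf nX).
by rewrite -scaleN1r invmxZ ?scaleN1r ?unitmxN // invrN invr1 scaleN1r.
Qed.

Lemma symp_part_unit E : ursubmx E \in unitmx -> symp_part E \in unitmx.
Proof. by move=> u; rewrite /symp_part unitmxN unitmx_inv. Qed.

Lemma invmx_symp_part E : invmx (symp_part E) = - ursubmx E.
Proof. by rewrite /symp_part invmxN invmxK. Qed.

Lemma symp_part_skew E : (ursubmx E)^T = - ursubmx E ->
  (symp_part E)^T = - symp_part E.
Proof. by move=> PT; rewrite /symp_part linearN /= trmx_inv PT invmxN. Qed.

Lemma B_part_skew E : ursubmx E \in unitmx -> (ursubmx E)^T = - ursubmx E ->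
  ulsubmx E *m ursubmx E = ursubmx E *m (ulsubmx E)^T -> (B_part E)^T = - B_part E.
Proof.
move=> uP PT AP; rewrite /B_part trmx_mul symp_part_skew // mulmxN; congr (- _).
rewrite /symp_part mulmxN mulNmx; congr (- _); apply: (can_inj (mulKmx uP)).
by rewrite mulmxA -AP mulmxK // mulKVmx.
Qed.

Lemma symp_normal_form E : E *m E = - 1%:M -> drsubmx E = - (ulsubmx E)^T ->
  ursubmx E \in unitmx -> E = Ad_mx (B_part E) (symp_mx (symp_part E)).
Proof.
move=> EE HD uP; have [AA AP _] := square_blocks EE HD.
have wP : symp_part E *m ursubmx E = - 1%:M by rewrite /symp_part mulNmx mulVmx.
have Pw : ursubmx E *m symp_part E = - 1%:M by rewrite /symp_part mulmxN mulmxV.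
rewrite Ad_symp_mx invmx_symp_part -[LHS]submxK /B_part opprK.
move: (symp_part E) wP Pw => w wP Pw; congr block_mx.
- by rewrite mulNmx mulmxA Pw mulNmx mul1mx opprK.
- rewrite mulmxN mulNmx -!mulmxA (mulmxA (ursubmx E)) Pw mulNmx mul1mx !mulmxN opprK.
  rewrite -{1}[w]mulmx1 -mulmxDr.
  have -> : 1%:M + ulsubmx E *m ulsubmx E = - (ursubmx E *m dlsubmx E).
    by apply/eqP; rewrite -addr_eq0 -addrA AA subrr.
  by rewrite mulmxN mulmxA wP mulNmx mul1mx opprK.
- by rewrite HD mulmxN opprK -mulmxA AP mulmxA wP mulNmx mul1mx.
Qed.

End AdExp.

Section AntiCommuting.
Variables (R : realType) (m : nat).
Implicit Types (B w J : 'M[R]_m).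

(** Both relations are blocks of the anticommutator, cleared of w1^-1. *)
Lemma anticomm_relations w1 w2 B p (A := B *m invmx w2) (D := w1 *m invmx w2 + p%:M) :
  w1 \in unitmx -> w2 \in unitmx ->
  symp_mx w1 *m Ad_mx B (symp_mx w2) + Ad_mx B (symp_mx w2) *m symp_mx w1 = (2%:R * p)%:M ->
  A *m A + D *m D = (p ^+ 2 - 1)%:M /\ A *m D = D *m A.
Proof.
move=> u1 u2; rewrite Ad_symp_mx /symp_mx !mulmx_block !mulmx0 !mul0mx !addr0 !add0r.
rewrite add_block_mx scalar_mx_block => /eq_block_mx[_ H1 _ H2].
pose G := w1 *m invmx w2.
have AG : A *m G = G *m A.
  move: H1; rewrite !mulNmx !mulmxN opprK => /eqP; rewrite subr_eq0 => /eqP H1.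
  have H : A *m w1 = w1 *m invmx w2 *m B.
    have uV : invmx w1 \in unitmx by rewrite unitmx_inv.
    apply: (can_inj (mulKmx uV)).
    by rewrite mulmxA -/A H1 mulmxKV // !mulmxA mulVmx // mul1mx.
  by rewrite /G mulmxA H /A !mulmxA.
(* the lower right block of the anticommutator, times G *)
have GG : G *m G + A *m A + (2%:R * p) *: G = - 1%:M.
  have := congr1 (mulmx^~ G) H2; rewrite mul_scalar_mx mulmxDl !mulmxN !mulNmx => <-.
  rewrite -/G [_ *m invmx w1 *m G]mulmxA mulmxKV // mulmxDl mulmxV //.
  rewrite -(mulmxA (B *m invmx w2)) -/A; move: (G *m G) (A *m A) => X Y.
  by apply/matrixP => i j; rewrite !mxE; ring.
rewrite /D -/G; split; last first.
  by rewrite mulmxDr mulmxDl AG scalar_mxC.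
rewrite mulmxDl !mulmxDr mul_scalar_mx mul_mx_scalar -scalar_mxM -expr2.
have -> : (p ^+ 2 - 1)%:M = (p ^+ 2)%:M - 1%:M :> 'M[R]_m.
  by apply/matrixP => i j; rewrite !mxE mulrnBl.
rewrite -GG; move: (G *m G) (A *m A) ((p ^+ 2)%:M) => X Y Z.
by apply/matrixP => i j; rewrite !mxE; ring.
Qed.

(** The bivectors of I1, I2 and the half commutator are - w1^-1, - w2^-1 and the
    half sum of w1^-1 B w2^-1 and w2^-1 B w1^-1; substituting B turns both of these
    into al w1^-1 + be w2^-1. *)
Lemma span_ur w1 w2 B (al be : R) : w1 \in unitmx -> w2 \in unitmx ->
  B = al *: w2 + be *: w1 ->
  let I1 := symp_mx w1 in let I2 := Ad_mx B (symp_mx w2) in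
  ursubmx (al *: I1 + be *: I2 + 2%:R^-1 *: (I1 *m I2 - I2 *m I1)) = 0.
Proof.
move=> u1 u2 BE; rewrite /= Ad_symp_mx /symp_mx !mulmx_block !mulmx0 !mul0mx !addr0 !add0r.
rewrite !scale_block_mx opp_block_mx !add_block_mx scale_block_mx add_block_mx block_mxKur.
rewrite !mulNmx !mulmxN !opprK BE !mulmxDr !mulmxDl -!scalemxAr -!scalemxAl.
rewrite mulmxV // mulVmx // mul1mx mulmxDr -!scalemxAr mulmx1 mulmxA mulVmx // mul1mx.
rewrite -mulmxA mulmxV // mulmx1.
move: (invmx w1) (invmx w2) => X Y; apply/matrixP => i j; rewrite !mxE; by field.
Qed.

(** In the gauge of w, anticommuting with the structure of w forces the lower left
    block of E to vanish. *)
Lemma anticomm_cplx B w (E : 'M[R]_(m + m)) : w \in unitmx -> ursubmx E = 0 ->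
  drsubmx E = - (ulsubmx E)^T ->
  E *m Ad_mx B (symp_mx w) + Ad_mx B (symp_mx w) *m E = 0 ->
  E = Ad_mx B (cplx_mx (ulsubmx E)) /\ w *m ulsubmx E = (ulsubmx E)^T *m w.
Proof.
move=> uw E0 ED EA; set J := ulsubmx E.
pose E' := Ad_mx (- B) E.
have EE' : E = Ad_mx B E' by rewrite /E' Ad_mx_comp subrr /Ad_mx oppr0 shear0 mul1mx mulmx1.
have E'E : E' = block_mx J 0 (dlsubmx E') (- J^T).
  rewrite /E' -[E]submxK E0 ED Ad_mx_block mul0mx !mulmx0 subr0 !add0r.
  by rewrite block_mxKdl.
have : E' *m symp_mx w + symp_mx w *m E' = 0.
  apply: (@Ad_mx_inj _ _ B); rewrite Ad_mxD (Ad_mxM B E') (Ad_mxM B _ E') -EE' EA.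
  by rewrite /Ad_mx mulmx0 mul0mx.
rewrite {1 2}E'E; move: (dlsubmx E') E'E => S E'E.
rewrite /symp_mx !mulmx_block !mulmx0 !mul0mx !addr0 !add0r add_block_mx -[0 in RHS]block_mx0.
move=> /eq_block_mx[H1 _ H3 _].
have S0 : S = 0.
  have uV : invmx w \in unitmx by rewrite unitmx_inv.
  apply: (can_inj (mulKmx uV)); rewrite mulmx0.
  by move/eqP: H1; rewrite add0r mulNmx oppr_eq0 => /eqP.
split; first by rewrite {1}EE' E'E S0.
by move/eqP: H3; rewrite mulNmx addrC subr_eq0 => /eqP.
Qed.

(** The third member of the quaternionic triple is again of symplectic kind, with
    2-form - w J. *)
Lemma cplx_symp_ur B w J : w \in unitmx -> J *m J = - 1%:M -> w *m J = J^T *m w ->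
  let E := Ad_mx B (cplx_mx J) *m Ad_mx B (symp_mx w) in
  ursubmx E \in unitmx /\ symp_part E = - (w *m J).
Proof.
move=> uw JJ wJ E.
have uJ : J \in unitmx.
  by apply: (proj1 (mulmx1_unit (B := - J) _)); rewrite mulmxN JJ opprK.
have EU : ursubmx E = - (J *m invmx w).
  rewrite /E -Ad_mxM Ad_mx_ur /cplx_mx /symp_mx mulmx_block block_mxKur.
  by rewrite mul0mx addr0 mulmxN.
have uE : ursubmx E \in unitmx by rewrite EU unitmxN unitmx_mul uJ unitmx_inv.
split=> //; rewrite /symp_part EU invmxN opprK.
have uV : J *m invmx w \in unitmx by rewrite unitmx_mul uJ unitmx_inv.
apply: (can_inj (mulKmx uV)); rewrite mulmxV // mulmxN -mulmxA mulKmx // JJ opprK //.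
Qed.

End AntiCommuting.

Section Twist.
Variables (R : realType) (m : nat).
Implicit Types (J s : 'M[R]_m).

Definition triangular_mx J s : 'M[R]_(m + m) := block_mx J 0 s (- J^T).

Lemma triangular_mxM J J' s s' : triangular_mx J s *m triangular_mx J' s' =
  block_mx (J *m J') 0 (s *m J' - J^T *m s') (J^T *m J'^T).
Proof.
rewrite /triangular_mx mulmx_block !mulmx0 !mul0mx !addr0 !add0r.
by rewrite mulNmx mulmxN mulNmx opprK.
Qed.

Lemma triangular_mxN J s : - triangular_mx J s = triangular_mx (- J) (- s).
Proof. by rewrite /triangular_mx opp_block_mx oppr0 [(- J)^T]linearN. Qed.

(** The 2-form whose graph is the average of the horizontal complement over the
    group generated by the three structures. *)
Definition twist J1 J2 J3 s1 s2 s3 : 'M[R]_m :=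
  - 4%:R^-1 *: (s1 *m J1 + s2 *m J2 + s3 *m J3).

Lemma twist_rot J1 J2 J3 s1 s2 s3 : twist J1 J2 J3 s1 s2 s3 = twist J2 J3 J1 s2 s3 s1.
Proof. by rewrite /twist -addrA addrC. Qed.

(** The graph of the average is invariant under E1: expand J1^T s_k J_k by means of
    the lower left blocks of the products E1 E_k. *)
Lemma twist_identity J1 J2 J3 s1 s2 s3 (E1 := triangular_mx J1 s1)
    (E2 := triangular_mx J2 s2) (E3 := triangular_mx J3 s3) (B := twist J1 J2 J3 s1 s2 s3) :
  E1 *m E1 = - 1%:M -> E2 *m E2 = - 1%:M -> E3 *m E3 = - 1%:M ->
  E1 *m E2 = E3 -> E2 *m E1 = - E3 -> E3 *m E1 = E2 -> E1 *m E3 = - E2 ->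
  B *m J1 + J1^T *m B = s1.
Proof.
rewrite scalar_mx_block opp_block_mx !oppr0 !triangular_mxM !triangular_mxN.
move=> /eq_block_mx[J11 _ /eqP s11 _] /eq_block_mx[J22 _ _ _] /eq_block_mx[J33 _ _ _].
move=> /eq_block_mx[_ _ s12 _] /eq_block_mx[J21 _ _ _] /eq_block_mx[J31 _ _ _].
move=> /eq_block_mx[_ _ s13 _].
move: s11; rewrite subr_eq0 => /eqP s11.
have e1 : J1^T *m (s1 *m J1) = - s1 by rewrite mulmxA -s11 -mulmxA J11 mulmxN mulmx1.
have e2 : J1^T *m (s2 *m J2) = - s1 - s3 *m J2.
  have -> : J1^T *m (s2 *m J2) = (s1 *m J2 - s3) *m J2.
    by rewrite -s12 opprB addrC subrK mulmxA.
  by rewrite mulmxBl -mulmxA J22 mulmxN mulmx1.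
have e3 : J1^T *m (s3 *m J3) = - s1 + s2 *m J3.
  have -> : J1^T *m (s3 *m J3) = (s1 *m J3 + s2) *m J3.
    by rewrite -[s2]opprK -s13 opprB addrC subrK mulmxA.
  by rewrite mulmxDl -mulmxA J33 mulmxN mulmx1.
rewrite /B /twist -scalemxAl -scalemxAr !mulmxDl !mulmxDr e1 e2 e3 -!mulmxA J11 J21 J31.
rewrite !mulmxN mulmx1; move: (s2 *m J3) (s3 *m J2) => X Y.
apply/matrixP => i j; rewrite !mxE; by field.
Qed.

Lemma type20_02_0 J : type20_02 J (0 : 'M[R]_m).
Proof. by move=> Z W _ _; rewrite /toC map_mx0 mulmx0 mul0mx. Qed.

End Twist.

(** * Quaternions and the unit sphere *)

Section Sphere.
Variable R : realType.
Implicit Types a b e v : R * R * R.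

Definition dot3 a b : R := a.1.1 * b.1.1 + a.1.2 * b.1.2 + a.2 * b.2.

Definition cross3 a b : R * R * R :=
  (a.1.2 * b.2 - a.2 * b.1.2, a.2 * b.1.1 - a.1.1 * b.2, a.1.1 * b.1.2 - a.1.2 * b.1.1).

Definition lin3 (x : R) a (y : R) b (z : R) (c : R * R * R) : R * R * R :=
  (x * a.1.1 + y * b.1.1 + z * c.1.1, x * a.1.2 + y * b.1.2 + z * c.1.2,
   x * a.2 + y * b.2 + z * c.2).

Definition quat N (I J K : 'M[R]_N) a : 'M[R]_N :=
  a.1.1 *: I + a.1.2 *: J + a.2 *: K.

Definition scale3 (k : R) (a : R * R * R) : R * R * R := (k * a.1.1, k * a.1.2, k * a.2).

Definition unit3 a : R * R * R := scale3 (Num.sqrt (dot3 a a))^-1 a.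

Lemma S2E a : S2 a <-> dot3 a a = 1.
Proof. by rewrite /S2 /dot3 /= !expr2. Qed.

Lemma cross3_norm a b :
  dot3 (cross3 a b) (cross3 a b) = dot3 a a * dot3 b b - dot3 a b ^+ 2.
Proof. rewrite /dot3 /=; ring. Qed.

(** Coordinates of c in the basis a, b, a x b: the Gram determinant of a, b is
    the square norm g of a x b. *)
Lemma cross3_decomp a b c (x := dot3 b b * dot3 c a - dot3 a b * dot3 c b)
    (y := dot3 a a * dot3 c b - dot3 a b * dot3 c a) (z := dot3 c (cross3 a b))
    (g := dot3 (cross3 a b) (cross3 a b)) :
  g != 0 -> c = lin3 (x / g) a (y / g) b (z / g) (cross3 a b).
Proof.
move=> g0; have E (p q : R) : g * p = q -> p = q / g by move=> <-; rewrite mulrC mulKf.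
rewrite [LHS]surjective_pairing [c.1]surjective_pairing /lin3.
have F (x' y' z' p q r g' : R) :
    x' / g' * p + y' / g' * q + z' / g' * r = (x' * p + y' * q + z' * r) / g' by ring.
rewrite !F; congr (_, _, _); apply: E; rewrite /g /x /y /z /dot3 /=; ring.
Qed.

Lemma dot3_ge0 (a : R * R * R) : 0 <= dot3 a a.
Proof. by rewrite /dot3 -!expr2 !addr_ge0 ?sqr_ge0. Qed.

Lemma dot3_eq0 (a : R * R * R) : dot3 a a = 0 -> a = (0, 0, 0).
Proof.
case: a => [[p q] r]; rewrite /dot3 /= => H.
have := sqr_ge0 p; have := sqr_ge0 q; have := sqr_ge0 r; rewrite !expr2 => r0 q0 p0.
have [/eqP + /eqP + /eqP] : [/\ p * p = 0, q * q = 0 & r * r = 0] by split; lra.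
by rewrite !mulf_eq0 !orbb => /eqP -> /eqP -> /eqP ->.
Qed.

Lemma dot3_scale3 k a : dot3 (scale3 k a) (scale3 k a) = k ^+ 2 * dot3 a a.
Proof. rewrite /dot3 /=; ring. Qed.

Lemma sqrt_dot3 a : dot3 a a != 0 -> Num.sqrt (dot3 a a) != 0.
Proof. by move=> a0; rewrite sqrtr_eq0 -ltNge lt0r a0 dot3_ge0. Qed.

Lemma unit3_S2 a : dot3 a a != 0 -> S2 (unit3 a).
Proof.
move=> a0; apply/S2E; rewrite dot3_scale3 exprVn sqr_sqrtr ?dot3_ge0 //.
by rewrite mulVf.
Qed.

(** One of the first two basis vectors works. *)
Lemma independent_direction a : S2 a ->
  exists e, dot3 (cross3 a e) (cross3 a e) != 0.
Proof.
case: a => [[p q] r]; rewrite /S2 /= => S.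
have [q0|q0] := boolP ((q == 0) && (r == 0)).
  exists (0, 1, 0); rewrite /dot3 /cross3 /=.
  move/andP: q0 => [/eqP q0 /eqP r0]; move: S; rewrite q0 r0 !expr2 => S.
  apply/eqP; lra.
exists (1, 0, 0); rewrite /dot3 /cross3 /=; apply: contraNneq q0.
rewrite !(mulr0, mul0r, mulr1, subr0, sub0r, addr0, add0r, mulrN, mulNr, opprK, oppr0) => H.
have := sqr_ge0 q; have := sqr_ge0 r; rewrite !expr2 => r0 q0.
have [/eqP + /eqP +] : q * q = 0 /\ r * r = 0 by split; lra.
by rewrite !mulf_eq0 !orbb => -> ->.
Qed.

Section Quaternions.
Variables (N : nat) (I J K : 'M[R]_N).
Hypotheses (II : I *m I = - 1%:M) (JJ : J *m J = - 1%:M) (KK : K *m K = - 1%:M).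
Hypotheses (IJ : I *m J = K) (JI : I *m J = - (J *m I)) (KI : I *m K = - (K *m I))
  (KJ : J *m K = - (K *m J)).

Lemma quat_lin3 x a y b z c :
  quat I J K (lin3 x a y b z c) = x *: quat I J K a + y *: quat I J K b + z *: quat I J K c.
Proof. by apply/matrixP => i j; rewrite /quat /lin3 !mxE /=; ring. Qed.

(** Multiplication of imaginary quaternions. *)
Lemma quatM a b : quat I J K a *m quat I J K b =
  - dot3 a b *: 1%:M + quat I J K (cross3 a b).
Proof.
have ji : J *m I = - K by rewrite -IJ JI opprK.
have jk : J *m K = I.
  by rewrite -IJ mulmxA ji -IJ mulNmx -mulmxA JJ mulmxN mulmx1 opprK.
have kj : K *m J = - I by rewrite -[K *m J]opprK -KJ jk.
have ik : I *m K = - J by rewrite -IJ mulmxA II mulNmx mul1mx.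
have ki : K *m I = J by rewrite -[K *m I]opprK -KI ik opprK.
rewrite {1 2}/quat !mulmxDl !mulmxDr -!scalemxAl -!scalemxAr II JJ KK IJ ji jk kj ik ki.
move: 1%:M => U; apply/matrixP => i j; rewrite /quat /dot3 /cross3 !mxE /=; ring.
Qed.

Lemma quat_comm a b :
  quat I J K a *m quat I J K b - quat I J K b *m quat I J K a =
  2%:R *: quat I J K (cross3 a b).
Proof.
rewrite !quatM; move: 1%:M => U; apply/matrixP => i j.
rewrite /quat /dot3 /cross3 !mxE /=; ring.
Qed.

Lemma quat_anticomm a b :
  quat I J K a *m quat I J K b + quat I J K b *m quat I J K a =
  (- 2%:R * dot3 a b) *: 1%:M.
Proof.
rewrite !quatM; move: 1%:M => U; apply/matrixP => i j.
rewrite /quat /dot3 /cross3 !mxE /=; ring.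
Qed.

End Quaternions.

Lemma coord_line_continuous (p q : R) :
  {for 0, continuous (fun s : R => 1 * p + s * q + 0 * p)}.
Proof.
apply: continuousD; last by apply: cst_continuous.
apply: continuousD; first by apply: cst_continuous.
by apply: continuousM; [exact: cvg_id|apply: cst_continuous].
Qed.

Lemma dot3_line_continuous a e :
  {for 0, continuous (fun s : R => dot3 (lin3 1 a s e 0 a) (lin3 1 a s e 0 a))}.
Proof.
by apply: continuousD; [apply: continuousD|]; apply: continuousM;
  exact: coord_line_continuous.
Qed.

Lemma unit3_line_continuous a e : S2 a ->
  unit3 (lin3 1 a s e 0 a) @[s --> (0 : R)] --> a.
Proof.
move=> /S2E n1; pose l (p q s : R) := 1 * p + s * q + 0 * p.
have lc (p q : R) : {for 0, continuous (l p q)} by exact: coord_line_continuous.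
pose n (s : R) := dot3 (lin3 1 a s e 0 a) (lin3 1 a s e 0 a).
have nc : {for 0, continuous n} by exact: dot3_line_continuous.
have n0 : n 0 = 1 by rewrite -n1 /n /dot3 /lin3 /=; ring.
pose k (s : R) := (Num.sqrt (n s))^-1.
have kc : {for 0, continuous k}.
  apply: continuousV; first by rewrite n0 sqrtr1 oner_neq0.
  by apply: continuous_comp; [exact: nc|exact: sqrt_continuous].
have H (p q : R) : k s * l p q s @[s --> (0 : R)] --> p.
  have : {for 0, continuous (fun s => k s * l p q s)} by apply: continuousM.
  rewrite /prop_for /continuous_at /k n0 sqrtr1 invr1 /l.
  by rewrite !mul1r !mul0r !addr0.
case: a @l lc @n nc n0 @k kc H n1 => [[a1 a2] a3] l lc n nc n0 k kc H n1.
have h1 := H a1 e.1.1; have h2 := H a2 e.1.2; have h3 := H a3 e.2.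
exact: cvg_pair (cvg_pair h1 h2) h3.
Qed.

(** Every neighbourhood of a unit vector contains normalized points of the line
    through it in any prescribed direction e; linear conditions near a thus also
    constrain e. *)
Lemma unit3_line_near a e (Q : set (R * R * R)) : S2 a -> nbhs a Q ->
  exists s : R, [/\ s != 0, dot3 (lin3 1 a s e 0 a) (lin3 1 a s e 0 a) != 0 &
    Q (unit3 (lin3 1 a s e 0 a))].
Proof.
move=> Sa nQ; have /S2E n1 := Sa.
have H1 : \forall s \near (0 : R), Q (unit3 (lin3 1 a s e 0 a)).
  exact: unit3_line_continuous Sa _ nQ.
have H2 : \forall s \near (0 : R), dot3 (lin3 1 a s e 0 a) (lin3 1 a s e 0 a) != 0.
  have n0 : dot3 (lin3 1 a 0 e 0 a) (lin3 1 a 0 e 0 a) = 1.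
    by rewrite -[RHS]n1 /dot3 /lin3 /=; ring.
  apply: (@dot3_line_continuous a e [set z | z != 0]); rewrite n0.
  by apply: open_nbhs_nbhs; split; [exact: open_neq|exact: oner_neq0].
near (0 : R)^' => s; exists s; split; near: s.
- exact: nbhs_dnbhs_neq.
- exact: nbhs_dnbhs H2.
- exact: nbhs_dnbhs H1.
Unshelve. all: by end_near. Qed.

End Sphere.

(** * Courant brackets of sections and integrability *)

Section CourantSections.
Variables (R : realType) (m : nat).

Lemma partialC_cst (i : 'I_m) (z : R[i]) u : partialC i (fun=> z) u = 0.
Proof. by rewrite /partialC !partial_cst. Qed.

Lemma sum_Complex (I : Type) (r : seq I) (P : pred I) (f g : I -> R) :
  \sum_(i <- r | P i) Complex (f i) (g i) =
  Complex (\sum_(i <- r | P i) f i) (\sum_(i <- r | P i) g i).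
Proof. by elim/big_rec3: _ => // i x y z _ ->. Qed.

Section Graph.
Variables (V : set 'cV[R]_m) (oV : open V).

(** The section of the graph of B - i w over the a-th coordinate vector field. *)
Definition graph_section (B w : 'cV[R]_m -> 'M[R]_m) (a : 'I_m) (v : 'cV[R]_m) :
    'cV[R[i]]_(m + m) :=
  col_mx (delta_mx a 0) (\col_i Complex (B v i a) (- w v i a)).

Lemma smooth_graph_section B w a : smooth_mx V B -> smooth_mx V w ->
  smoothC_on V (graph_section B w a).
Proof.
move=> sB sw i; rewrite /graph_section; case: (splitP i) => k ik.
  have -> : i = lshift m k by apply/val_inj.
  split; apply: eq_smooth_on (smooth_on_cst _ _) => // u _; rewrite col_mxEu mxE //.
have -> : i = rshift m k by apply/val_inj.
split.
  by apply: eq_smooth_on (sB k a) => // u _; rewrite col_mxEd mxE.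
by apply: eq_smooth_on (smooth_on_opp oV (sw k a)) => // u _; rewrite col_mxEd mxE.
Qed.

Definition ext_deriv (B : 'cV[R]_m -> 'M[R]_m) u (i j k : 'I_m) : R :=
  partial i (fun v => B v j k) u + partial j (fun v => B v k i) u
  + partial k (fun v => B v i j) u.

Lemma partial_skew (B : 'cV[R]_m -> 'M[R]_m) i j k u : smooth_mx V B -> (forall v, V v -> (B v)^T = - B v) ->
  V u -> partial i (fun v => B v j k) u = - partial i (fun v => B v k j) u.
Proof.
move=> sB BT Vu; rewrite -(partialN i (sB k j) Vu).
by apply: (@eq_partial _ _ V) => // v /BT /matrixP/(_ k j); rewrite !mxE.
Qed.

(** The coordinate fields are constant, so only the derivatives of the 2-forms
    survive, and skewness combines the three of them into the exterior derivative. *)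
Lemma courant_graph (B w : 'cV[R]_m -> 'M[R]_m) a b u : smooth_mx V B -> smooth_mx V w ->
  (forall v, V v -> (B v)^T = - B v) -> (forall v, V v -> (w v)^T = - w v) -> V u ->
  courant (graph_section B w a) (graph_section B w b) u =
  col_mx (0 : 'cV[R[i]]_m) (\col_(i < m) Complex (ext_deriv B u a i b) (- ext_deriv w u a i b)).
Proof.
move=> sB sw BT wT Vu; rewrite /courant.
have X c : (fun v => usubmx (graph_section B w c v)) = fun=> delta_mx c 0.
  by apply/funext => v; rewrite /graph_section col_mxKu.
have Y c : (fun v => dsubmx (graph_section B w c v)) =
    fun v => \col_i Complex (B v i c) (- w v i c).
  by apply/funext => v; rewrite /graph_section col_mxKd.
rewrite !X !Y; congr col_mx.
  by apply/colP => i; rewrite !mxE big1 // => j _; rewrite !partialC_cst !mulr0 subrr.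
have L c d : lie_derivative (fun=> delta_mx c 0)
    (fun v => \col_i Complex (B v i d) (- w v i d)) u =
    \col_i Complex (partial c (fun v => B v i d) u) (- partial c (fun v => w v i d) u).
  apply/colP => i; rewrite !mxE (bigD1 c) //= big1 ?addr0 => [|j jc].
    rewrite !mxE eqxx mul1r partialC_cst mulr0 addr0.
    rewrite -(partialN c (sw i d) Vu).
    rewrite /partialC; congr Complex; congr (partial c _ u); apply/funext => v.
      by rewrite mxE.
    by rewrite mxE.
  by rewrite !mxE (negPf jc) /= mul0r partialC_cst mulr0 addr0.
have C c d v : Defs.contract (fun=> delta_mx c 0)
    (fun v => \col_i Complex (B v i d) (- w v i d)) v = Complex (B v c d) (- w v c d).
  rewrite /Defs.contract (bigD1 c) //= big1 ?addr0 => [|j jc]; first by rewrite !mxE eqxx mul1r.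
  by rewrite !mxE (negPf jc) mul0r.
rewrite !L; apply/colP => i; rewrite !mxE.
have -> : partialC i (fun v => Defs.contract (fun=> delta_mx a 0)
       (fun v0 => \col_i0 Complex (B v0 i0 b) (- w v0 i0 b)) v -
     Defs.contract (fun=> delta_mx b 0)
       (fun v0 => \col_i0 Complex (B v0 i0 a) (- w v0 i0 a)) v) u =
   Complex (2%:R * partial i (fun v => B v a b) u) (- (2%:R * partial i (fun v => w v a b) u)).
  rewrite /partialC; congr Complex.
    rewrite mulr_natl mulr2n -(partialD i (sB a b) (sB a b) Vu).
    apply: (@eq_partial _ _ V) => // v Vv; rewrite !C /=.
    by have /matrixP/(_ a b) := BT v Vv; rewrite !mxE => ->; rewrite opprK.
  rewrite mulr_natl mulr2n -(partialD i (sw a b) (sw a b) Vu).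
  rewrite -(partialN i (smooth_on_add oV (sw a b) (sw a b)) Vu).
  apply: (@eq_partial _ _ V) => // v Vv; rewrite !C /=.
  by have /matrixP/(_ a b) := wT v Vv; rewrite !mxE => ->; ring.
have half (x y : R) : 2%:R^-1 * Complex (2%:R * x) (- (2%:R * y)) = Complex x (- y).
  apply: (@mulfI _ (2%:R : R[i])); first by rewrite pnatr_eq0.
  rewrite mulrA mulfV ?pnatr_eq0 // mul1r mulr_natl mulr2n /=.
  by apply/eqP; rewrite eq_complex /=; apply/andP; split; apply/eqP; ring.
rewrite half /ext_deriv.
rewrite (partial_skew b i a sB BT Vu) (partial_skew b i a sw wT Vu).
rewrite (partial_skew i a b sB BT Vu) (partial_skew i a b sw wT Vu).
apply/eqP; rewrite eq_complex /=; apply/andP; split; apply/eqP; ring.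
Qed.

End Graph.
End CourantSections.

Section Integrability.
Variables (R : realType) (m : nat) (M : smooth_manifold R m).
Implicit Types (U : set M) (E : tfield M (m + m) (m + m)).

Lemma smooth_field_sub k l U U' (F : tfield M k l) : U' `<=` U ->
  smooth_field U F -> smooth_field U' F.
Proof.
move=> sU sF c i j; apply: smooth_on_sub (sF c i j) => _ [x [cx Ux] <-].
by exists x => //; split => //; exact: sU.
Qed.

Lemma gen_complex_sub U U' E : U' `<=` U -> gen_complex U E -> gen_complex U' E.
Proof.
move=> sU [[sE tE oE qE] iE]; split; first split.
- exact: smooth_field_sub sE.
- by move=> c c' x /sU; exact: tE.
- by move=> c x /sU; exact: oE.
- by move=> c x /sU; exact: qE.
move=> c V s t oV VU; apply: iE => //; apply: subset_trans VU _ => _ [x [cx Ux] <-].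
by exists x => //; split => //; exact: sU.
Qed.

Section Local.
Variables (U : set M) (E : tfield M (m + m) (m + m)).
Hypotheses (oU : open U) (gE : gen_complex U E).

Lemma gc_smooth : smooth_field U E. Proof. by case: gE => -[]. Qed.

Lemma gc_trans c c' x : U x -> dom c x -> dom c' x ->
  E c' x *m gtrans c c' x = gtrans c c' x *m E c x.
Proof. by case: gE => -[_ + _ _] _; exact. Qed.

Lemma gc_square c x : U x -> dom c x -> E c x *m E c x = - 1%:M.
Proof. by case: gE => -[_ _ _ +] _; exact. Qed.

Lemma gc_blocks c x : U x -> dom c x ->
  [/\ drsubmx (E c x) = - (ulsubmx (E c x))^T, (ursubmx (E c x))^T = - ursubmx (E c x) &
      (dlsubmx (E c x))^T = - dlsubmx (E c x)].
Proof.
move=> Ux cx; apply: orthogonal_blocks; last exact: gc_square.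
by case: gE => -[_ _ + _] _; exact.
Qed.

Lemma gc_trans_blocks c c' x (T := trans c c' x) : U x -> dom c x -> dom c' x ->
  [/\ ulsubmx (E c' x) *m T = T *m ulsubmx (E c x),
      ursubmx (E c' x) = T *m ursubmx (E c x) *m T^T &
      T^T *m dlsubmx (E c' x) *m T = dlsubmx (E c x)].
Proof.
move=> Ux cx c'x; have uT : T \in unitmx by exact: trans_unit.
have uTT : T^T \in unitmx by rewrite unitmx_tr.
have := gc_trans Ux cx c'x; rewrite /gtrans -[E c' x]submxK -[E c x]submxK.
rewrite !mulmx_block !mulmx0 !mul0mx !addr0 !add0r !block_mxKul !block_mxKur !block_mxKdl.
move=> /eq_block_mx[-> H1 H2 _]; split=> //.
  by rewrite -H1 mulmxKV.
by rewrite -mulmxA H2 mulKVmx.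
Qed.

Lemma smooth_mx_read k l (F : tfield M k l) c : smooth_field U F ->
  smooth_mx (readout c U) (fun u => F c (par c u)).
Proof. by move=> sF i j; exact: sF. Qed.

Lemma gc_courant c s t : smoothC_on (readout c U) s -> smoothC_on (readout c U) t ->
  eigen_section E c (readout c U) s -> eigen_section E c (readout c U) t ->
  eigen_section E c (readout c U) (courant s t).
Proof. by case: gE => _; apply=> //; exact: open_readout. Qed.

Definition tangent_part : tfield M m m := fun c x => ulsubmx (E c x).

Lemma smooth_tangent_part : smooth_field U tangent_part.
Proof.
move=> c i j; apply: eq_smooth_on (@smooth_mx_read _ _ _ c gc_smooth (lshift m i) (lshift m j)).
  exact: open_readout.
by move=> v _; rewrite !mxE.
Qed.

(** The section (1 - i E) d_a of the i-eigenbundle: E (1 - i E) = i (1 - i E). *)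
Definition image_section c (a : 'I_m) (v : 'cV[R]_m) : 'cV[R[i]]_(m + m) :=
  \col_i Complex ((i == lshift m a)%:R) (- E c (par c v) i (lshift m a)).

Lemma eigen_image_section c a : eigen_section E c (readout c U) (image_section c a).
Proof.
move=> u /readout_par[cu Uu _]; have EE := gc_square Uu cu.
pose e : 'cV[R[i]]_(m + m) := delta_mx (lshift m a) 0.
have -> : image_section c a u = e - 'i%C *: (toC (E c (par c u)) *m e).
  apply/colP => i; rewrite !mxE (bigD1 (lshift m a)) //= big1 ?addr0 => [|j ja].
    rewrite !mxE !eqxx mulr1 andbT.
    by case: eqVneq => _; apply: complex_ext => /=; ring.
  by rewrite !mxE (negPf ja) mulr0.
have ii : 'i%C * 'i%C = -1 :> R[i] by rewrite -expr2 sqr_i.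
rewrite mulmxBr -scalemxAr mulmxA -toC_mul EE scalerBr scalerA ii scaleN1r opprK.
by rewrite /toC map_mxN map_mx1 mulNmx mul1mx scalerN opprK addrC.
Qed.

Lemma smooth_image_section c a : smoothC_on (readout c U) (image_section c a).
Proof.
move=> i; have oV := @open_readout _ _ _ c _ oU; split.
  by apply: eq_smooth_on (smooth_on_cst _ ((i == lshift m a)%:R)) => // u _; rewrite mxE.
apply: eq_smooth_on (smooth_on_opp oV (@smooth_mx_read _ _ _ c gc_smooth i (lshift m a))) => //.
by move=> u _; rewrite mxE.
Qed.

(** When the bivector vanishes, A X is the vector part of E (X + xi), so the Lie
    bracket of (1 - i A) d_a and (1 - i A) d_b is again an i-eigenvector of A; the
    imaginary part of this eigenvector equation is the vanishing of the
    Nijenhuis tensor. *)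
Lemma gc_nijenhuis : everywhere U (fun c x => ursubmx (E c x) = 0) ->
  everywhere U (fun c x => forall i j k, nijenhuis tangent_part c x i j k = 0).
Proof.
move=> E0 c x Ux cx a b k; set u := crd c x.
have Vu : readout c U u by exact: readout_crd.
have pu : par c u = x by exact: crdK.
pose X d v : 'cV[R[i]]_m := \col_i Complex ((i == d)%:R) (- tangent_part c (par c v) i d).
have XE d : (fun v => usubmx (image_section c d v)) = X d.
  apply/funext => v; apply/colP => i; rewrite !mxE.
  by rewrite (inj_eq (@lshift_inj _ _)).
pose D (l i j : 'I_m) := dfield tangent_part c x l i j.
have sJ i j : smooth_on (readout c U) (fun v => tangent_part c (par c v) i j).
  apply: eq_smooth_on (@smooth_mx_read _ _ _ c gc_smooth (lshift m i) (lshift m j)).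
    exact: open_readout.
  by move=> v _; rewrite !mxE.
have dX j i d : partialC j (fun v => X d v i 0) u = Complex 0 (- D j i d).
  rewrite /partialC; congr Complex.
    by rewrite -[RHS](partial_cst j ((i == d)%:R : R) u); congr partial; apply/funext => v; rewrite mxE.
  rewrite -(partialN j (sJ i d) Vu); congr (partial j _ u).
  by apply/funext => v; rewrite mxE.
pose P i := \sum_l (tangent_part c x l a * D l i b - tangent_part c x l b * D l i a).
pose Q i := D a i b - D b i a.
have L : lie_bracket (X a) (X b) u = \col_i Complex (- P i) (- Q i).
  apply/colP => i; rewrite !mxE.
  have -> : \sum_j (X a u j 0 * partialC j (fun v => X b v i 0) u -
        X b u j 0 * partialC j (fun v => X a v i 0) u) =
      \sum_j Complex (- (tangent_part c x j a * D j i b - tangent_part c x j b * D j i a))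
        (- ((j == a)%:R * D j i b - (j == b)%:R * D j i a)).
    apply: eq_bigr => j _; rewrite !dX !mxE pu.
    apply: complex_ext => /=; ring.
  rewrite sum_Complex; congr Complex; first by rewrite sumrN.
  rewrite sumrN; congr (- _); rewrite sumrB; congr (_ - _).
    by rewrite (bigD1 a) //= eqxx mul1r big1 ?addr0 // => j /negPf ->; rewrite mul0r.
  by rewrite (bigD1 b) //= eqxx mul1r big1 ?addr0 // => j /negPf ->; rewrite mul0r.
have := gc_courant (smooth_image_section c a) (smooth_image_section c b)
  (@eigen_image_section c a) (@eigen_image_section c b) Vu.
rewrite /courant !XE L pu; set rest := (X in col_mx _ X).
rewrite -{1}[E c x]submxK E0 // /toC map_block_mx map_mx0 mul_block_col mul0mx addr0.
rewrite scale_col_mx => /eq_col_mx[/colP/(_ k)] + _.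
rewrite !mxE.
have -> : \sum_j (map_mx (real_complex R) (ulsubmx (E c x))) k j *
    (\col_i Complex (- P i) (- Q i)) j 0 =
   \sum_j Complex (- (tangent_part c x k j * P j)) (- (tangent_part c x k j * Q j)).
  apply: eq_bigr => j _; rewrite !mxE /tangent_part ?mxE.
  apply: complex_ext => /=; ring.
rewrite sum_Complex => /(congr1 (@complex.Im R)) /=.
rewrite sumrN mul0r add0r mul1r => /oppr_inj H.
by rewrite /nijenhuis -[X in X - _]/(P k) -H subrr.
Qed.

Section Nondegenerate.
Hypothesis uE : everywhere U (fun c x => ursubmx (E c x) \in unitmx).

Definition symp_field : tfield M m m := fun c x => symp_part (E c x).

Definition B_field : tfield M m m := fun c x => B_part (E c x).

Lemma smooth_symp_field : smooth_field U symp_field.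
Proof.
move=> c; apply: smooth_mx_opp; first exact: open_readout.
apply: smooth_mx_inv; first exact: open_readout.
  by move=> u /readout_par[cu Uu _]; exact: uE.
move=> i j; apply: eq_smooth_on (@smooth_mx_read _ _ _ c gc_smooth (lshift m i) (rshift m j)).
  exact: open_readout.
by move=> v _; rewrite !mxE.
Qed.

Lemma smooth_B_field : smooth_field U B_field.
Proof.
move=> c; apply: smooth_mx_mul; first exact: open_readout.
  exact: smooth_symp_field.
exact: smooth_tangent_part.
Qed.

Lemma gc_normal_form c x : U x -> dom c x ->
  E c x = Ad_mx (B_field c x) (symp_mx (symp_field c x)).
Proof.
move=> Ux cx; apply: symp_normal_form; first exact: gc_square.
  by have [] := gc_blocks Ux cx.
exact: uE.
Qed.

Lemma symp_field_skew c x : U x -> dom c x -> (symp_field c x)^T = - symp_field c x.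
Proof. by move=> Ux cx; apply: symp_part_skew; have [] := gc_blocks Ux cx. Qed.

Lemma B_field_skew c x : U x -> dom c x -> (B_field c x)^T = - B_field c x.
Proof.
move=> Ux cx; have [D PT _] := gc_blocks Ux cx.
by apply: B_part_skew => //; [exact: uE|have [] := square_blocks (gc_square Ux cx) D].
Qed.

Lemma symp_field_trans c c' x : U x -> dom c x -> dom c' x ->
  (trans c c' x)^T *m symp_field c' x *m trans c c' x = symp_field c x.
Proof.
move=> Ux cx c'x; have [_ H _] := gc_trans_blocks Ux cx c'x.
have uT : trans c c' x \in unitmx by exact: trans_unit.
have uTT : (trans c c' x)^T \in unitmx by rewrite unitmx_tr.
rewrite /symp_field /symp_part mulmxN mulNmx; congr (- _).
have uP := uE Ux cx; have uP' := uE Ux c'x.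
apply: (can_inj (mulKmx uP)); rewrite mulmxV //.
apply: (can_inj (mulKmx uT)); rewrite mulmx1 !mulmxA -H.
by rewrite mulmxV // mul1mx.
Qed.

Lemma B_field_trans c c' x : U x -> dom c x -> dom c' x ->
  (trans c c' x)^T *m B_field c' x *m trans c c' x = B_field c x.
Proof.
move=> Ux cx c'x; have [H _ _] := gc_trans_blocks Ux cx c'x.
rewrite /B_field /B_part -[symp_part _]/(symp_field c' x) -[symp_part _]/(symp_field c x).
by rewrite -!mulmxA H !mulmxA symp_field_trans.
Qed.

Lemma eigen_graph_section c a : eigen_section E c (readout c U)
  (graph_section (fun u => B_field c (par c u)) (fun u => symp_field c (par c u)) a).
Proof.
move=> u /readout_par[cu Uu _]; rewrite (gc_normal_form Uu cu) Ad_symp_mx /graph_section.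
set B := B_field _ _; set w := symp_field _ _.
have uw : w \in unitmx by apply: symp_part_unit; exact: uE.
move: B w uw => B w uw; have -> : \col_i Complex (B i a) (- w i a) = (toC B - 'i%C *: toC w) *m delta_mx a 0.
  apply/colP => i; rewrite !mxE (bigD1 a) //= big1 => [|j ja].
    by rewrite !mxE !eqxx mulr1 addr0; apply: complex_ext => /=; ring.
  by rewrite !mxE (negPf ja) mulr0.
set e := delta_mx a 0; rewrite /toC map_block_mx -!/(toC _) mul_block_col scale_col_mx.
have ii : 'i%C * 'i%C = -1 :> R[i] by rewrite -expr2 sqr_i.
have toCN k l (X : 'M[R]_(k, l)) : toC (- X) = - toC X by exact: map_mxN.
have toCD k l (X Y : 'M[R]_(k, l)) : toC (X + Y) = toC X + toC Y by exact: map_mxD.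
have Vw : toC (invmx w) *m toC w = 1%:M by rewrite -toC_mul mulVmx // /toC map_mx1.
have wV : toC w *m toC (invmx w) = 1%:M by rewrite -toC_mul mulmxV // /toC map_mx1.
rewrite !toCN toCD !toC_mul !mulNmx; congr col_mx.
  rewrite mulmxBl !mulmxBr -!mulmxA -scalemxAl -scalemxAr (mulmxA (toC (invmx w)) (toC w)).
  by rewrite Vw mul1mx opprB addrC subrK.
rewrite mulmxDl mulmxBl mulmxBr -scalemxAl -scalemxAr -!mulmxA.
rewrite (mulmxA (toC (invmx w)) (toC w)) Vw mul1mx scalerBr scalerA ii scaleN1r opprK opprB.
by rewrite addrACA subrr addr0 addrC.
Qed.

Lemma smooth_gc_graph c a : smoothC_on (readout c U)
  (graph_section (fun u => B_field c (par c u)) (fun u => symp_field c (par c u)) a).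
Proof.
apply: smooth_graph_section; first exact: open_readout.
  exact: smooth_B_field.
exact: smooth_symp_field.
Qed.

(** The bracket of two graph sections is a covector in the i-eigenbundle, and an
    invertible bivector leaves no room for one. *)
Lemma gc_ext_deriv c x i j k : U x -> dom c x ->
  ext_deriv (fun u => B_field c (par c u)) (crd c x) i j k = 0 /\
  ext_deriv (fun u => symp_field c (par c u)) (crd c x) i j k = 0.
Proof.
move=> Ux cx; have Vu : readout c U (crd c x) by exact: readout_crd.
have := gc_courant (@smooth_gc_graph c i) (@smooth_gc_graph c k)
  (@eigen_graph_section c i) (@eigen_graph_section c k) Vu.
rewrite (@courant_graph _ _ (readout c U)) ?crdK //; last 5 first.
- exact: open_readout.
- exact: smooth_B_field.
- exact: smooth_symp_field.
- by move=> v /readout_par[cv Uv _]; exact: B_field_skew.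
- by move=> v /readout_par[cv Uv _]; exact: symp_field_skew.
move=> /form_eigenP[+ _]; set y := \col_i _.
have uP := uE Ux cx.
move=> /(congr1 (mulmx (toC (invmx (ursubmx (E c x)))))).
rewrite mulmx0 mulmxA -toC_mul mulVmx // /toC map_mx1 mul1mx => /colP/(_ j).
by rewrite !mxE => -[-> /eqP]; rewrite oppr_eq0 => /eqP.
Qed.

Lemma gc_symplectic : symplectic U symp_field /\ closed_form2 U B_field.
Proof.
split; last first.
  split; last by move=> c x Ux cx i j k; have [] := gc_ext_deriv i j k Ux cx.
  split; [exact: smooth_B_field|by move=> c x; exact: B_field_skew|].
  by move=> c c' x; exact: B_field_trans.
split; last by move=> c x Ux cx; apply: symp_part_unit; exact: uE.
split; last by move=> c x Ux cx i j k; have [] := gc_ext_deriv i j k Ux cx.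
split; [exact: smooth_symp_field|by move=> c x; exact: symp_field_skew|].
by move=> c c' x; exact: symp_field_trans.
Qed.

End Nondegenerate.
End Local.

Lemma eq_closed_form2 U (B B' : tfield M m m) : open U ->
  everywhere U (fun c x => B c x = B' c x) -> closed_form2 U B -> closed_form2 U B'.
Proof.
move=> oU BB [[sB aB tB] cB].
have E c u : readout c U u -> B c (par c u) = B' c (par c u).
  by move=> /readout_par[cu Uu _]; exact: BB.
split; first split.
- move=> c; apply: (@eq_smooth_mx _ _ (readout c U) _ _ _ (fun u => B c (par c u))).
  + exact: open_readout.
  + by move=> u /E.
  + exact: sB.
- by move=> c x Ux cx; rewrite -BB //; exact: aB.
- by move=> c c' x Ux cx c'x; rewrite -!BB //; exact: tB.
move=> c x Ux cx i j k; rewrite -[RHS](cB c x Ux cx i j k) /dfield.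
have H l a b : partial l (fun u => B' c (par c u) a b) (crd c x) =
    partial l (fun u => B c (par c u) a b) (crd c x).
  apply: (@eq_partial _ _ (readout c U)).
  - exact: open_readout.
  - by move=> u /E ->.
  - exact: readout_crd.
by rewrite !H.
Qed.

Lemma closed_form2_sub U (B B' : tfield M m m) : open U ->
  closed_form2 U B -> closed_form2 U B' ->
  closed_form2 U (fun c x => B c x - B' c x).
Proof.
move=> oU [[sB aB tB] cB] [[sB' aB' tB'] cB']; split; first split.
- move=> c; apply: smooth_mx_add; [exact: open_readout|exact: sB|].
  by apply: smooth_mx_opp; [exact: open_readout|exact: sB'].
- by move=> c x Ux cx; rewrite linearB /= aB // aB' // opprB opprK addrC.
- by move=> c c' x Ux cx c'x; rewrite mulmxBr mulmxBl tB // tB'.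
move=> c x Ux cx i j k; have Vu : readout c U (crd c x) by exact: readout_crd.
have oV := @open_readout _ _ _ c _ oU.
have H l a b : dfield (fun c x => B c x - B' c x) c x l a b =
    dfield B c x l a b - dfield B' c x l a b.
  rewrite /dfield -(partialN l (sB' c a b) Vu).
  rewrite -(partialD l (sB c a b) (smooth_on_opp oV (sB' c a b)) Vu).
  by apply: (eq_partial l oV) => // u _; rewrite !mxE.
rewrite !H; have := cB c x Ux cx i j k; have := cB' c x Ux cx i j k.
move: (dfield _ _ _ _ _ _) (dfield _ _ _ _ _ _) (dfield _ _ _ _ _ _) => p q r.
move: (dfield _ _ _ _ _ _) (dfield _ _ _ _ _ _) (dfield _ _ _ _ _ _) => p' q' r'; lra.
Qed.

Lemma complex_structure_tangent_part U (E : tfield M (m + m) (m + m)) : open U ->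
  gen_complex U E -> everywhere U (fun c x => ursubmx (E c x) = 0) ->
  complex_structure U (tangent_part E).
Proof.
move=> oU gE E0; split.
- exact: smooth_tangent_part.
- by move=> c c' x Ux cx c'x; have [] := gc_trans_blocks gE Ux cx c'x.
- move=> c x Ux cx; have [D _ _] := gc_blocks gE Ux cx.
  by have [<- _ _] := square_blocks (gc_square gE Ux cx) D; rewrite E0 // mul0mx addr0.
- exact: gc_nijenhuis.
Qed.

End Integrability.

(** * The sphere of structures of a generalized hypercomplex manifold *)

Section Family.
Variables (R : realType) (m : nat) (M : smooth_manifold R m).
Variables I J K : tfield M (m + m) (m + m).
Hypothesis hIJK : gen_hypercomplex [set: M] I J K.
Local Notation F := (s2family I J K).
Implicit Types (U : set M).

Lemma family_gc a U : S2 a -> gen_complex U (F a).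
Proof. by case: hIJK => _ _ _ _ H /H; exact: gen_complex_sub. Qed.

Lemma familyM a b c x : dom c x -> F a c x *m F b c x =
  - dot3 a b *: 1%:M + F (cross3 a b) c x.
Proof.
move=> cx; have [hI hJ hK hQ _] := hIJK; have [q1 q2 q3 q4] := hQ c x Logic.I cx.
by apply: quatM => //; [exact: (gc_square hI)|exact: (gc_square hJ)|exact: (gc_square hK)].
Qed.

Lemma family_lin3 p a q b r d c x :
  F (lin3 p a q b r d) c x = p *: F a c x + q *: F b c x + r *: F d c x.
Proof. exact: quat_lin3. Qed.

Lemma family_scale3 k a c x : F (scale3 k a) c x = k *: F a c x.
Proof. by rewrite /F /s2family /= !scalerDr !scalerA. Qed.

Lemma family_ur_scale3 k a c x :
  ursubmx (F (scale3 k a) c x) = k *: ursubmx (F a c x).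
Proof. by rewrite family_scale3; apply/matrixP => i j; rewrite !mxE. Qed.

Lemma family_square a c x : dom c x -> F a c x *m F a c x = - dot3 a a *: 1%:M.
Proof.
move=> cx; rewrite familyM // (_ : cross3 a a = (0, 0, 0)); last first.
  by rewrite /cross3; congr (_, _, _); ring.
by rewrite /F /s2family !scale0r !addr0.
Qed.

Lemma family_anticomm a b c x : dom c x ->
  F a c x *m F b c x + F b c x *m F a c x = (- 2%:R * dot3 a b) *: 1%:M.
Proof.
move=> cx; have [hI hJ hK hQ _] := hIJK; have [q1 q2 q3 q4] := hQ c x Logic.I cx.
by apply: quat_anticomm => //; [exact: (gc_square hI)|exact: (gc_square hJ)|exact: (gc_square hK)].
Qed.

Lemma family_comm a b c x : dom c x ->
  F a c x *m F b c x - F b c x *m F a c x = 2%:R *: F (cross3 a b) c x.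
Proof.
move=> cx; have [hI hJ hK hQ _] := hIJK; have [q1 q2 q3 q4] := hQ c x Logic.I cx.
by apply: quat_comm => //; [exact: (gc_square hI)|exact: (gc_square hJ)|exact: (gc_square hK)].
Qed.

(** F(a0), F(a1) and their commutator 2 F(a0 x a1) span the image of F, and the
    square of F(a) is - <a, a>, so that T^2 = - 1 singles out the sphere. *)
Lemma Ad_determined_span U (B : tfield M m m) I1 I2 a0 a1 x : U x ->
  S2 a0 -> S2 a1 -> dot3 (cross3 a0 a1) (cross3 a0 a1) != 0 ->
  everywhere U (fun c y => F a0 c y = Ad_mx (B c y) (I1 c y)) ->
  everywhere U (fun c y => F a1 c y = Ad_mx (B c y) (I2 c y)) ->
  Ad_determined U F B I1 I2.
Proof.
move=> Ux S0 S1 g0 H1 H2.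
pose T al be ga : tfield M (m + m) (m + m) := fun c y =>
  al *: I1 c y + be *: I2 c y + ga *: (I1 c y *m I2 c y - I2 c y *m I1 c y).
have FT al be ga c y : U y -> dom c y ->
    Ad_mx (B c y) (T al be ga c y) = F (lin3 al a0 be a1 (2%:R * ga) (cross3 a0 a1)) c y.
  move=> Uy cy; rewrite family_lin3 (mulrC 2%:R) -scalerA -family_comm //.
  by rewrite /T !Ad_mxD !Ad_mxZ Ad_mxD Ad_mxN !Ad_mxM -H1 // -H2.
split=> [a Sa|T' [[al [be [ga TE]]] TT]].
  have E := cross3_decomp a g0.
  move: E; set al' := _ / _; set be' := _ / _; set ga' := _ / _ => E.
  have FE c y : U y -> dom c y -> F a c y = Ad_mx (B c y) (T al' be' (ga' / 2%:R) c y).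
    by move=> Uy cy; rewrite FT // mulrCA mulfV ?pnatr_eq0 // mulr1 -E.
  exists (T al' be' (ga' / 2%:R)); split; last exact: FE.
  split; first by exists al', be', (ga' / 2%:R).
  move=> c y Uy cy; apply: (@Ad_mx_inj _ _ (B c y)).
  rewrite Ad_mxM -FE // family_square // (S2E a).1 // scaleN1r Ad_mxN.
  by rewrite Ad_mx1.
pose a := lin3 al a0 be a1 (2%:R * ga) (cross3 a0 a1).
have FE c y : U y -> dom c y -> F a c y = Ad_mx (B c y) (T' c y).
  by move=> Uy cy; rewrite TE // -FT.
(* for m = 0 the equation T^2 = - 1 carries no information *)
case: (posnP m) => [m0|mp].
  by exists a0; split=> // c y Uy cy; apply: mx0_eq; rewrite m0.
exists a; split=> //.
have [c cx] := dom_cover x; apply/S2E.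
have := family_square a cx; rewrite FE // -Ad_mxM TT // Ad_mxN Ad_mx1 -scaleN1r.
by move=> /scalar1_inj H; apply/esym/oppr_inj; apply: H; rewrite addn_gt0 mp.
Qed.

End Family.

Section FamilyCharts.
Variables (R : realType) (m : nat) (M : smooth_manifold R m).
Variables I J K : tfield M (m + m) (m + m).
Hypothesis hIJK : gen_hypercomplex [set: M] I J K.
Local Notation F := (s2family I J K).
Implicit Types (a b v : R * R * R) (U : set M) (x : M) (c : chart M).

Lemma family_ur_chart a c c' x : S2 a -> dom c x -> dom c' x ->
  ursubmx (F a c' x) = trans c c' x *m ursubmx (F a c x) *m (trans c c' x)^T.
Proof.
move=> Sa cx c'x.
by have [] := gc_trans_blocks (family_gc hIJK setT Sa) Logic.I cx c'x.
Qed.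

Lemma family_ur_unit a c c' x : S2 a -> dom c x -> dom c' x ->
  ursubmx (F a c x) \in unitmx -> ursubmx (F a c' x) \in unitmx.
Proof.
move=> Sa cx c'x u; rewrite (family_ur_chart Sa cx c'x) !unitmx_mul unitmx_tr u.
by rewrite trans_unit.
Qed.

Lemma family_ur0 a c c' x : S2 a -> dom c x -> dom c' x ->
  ursubmx (F a c x) = 0 -> ursubmx (F a c' x) = 0.
Proof. by move=> Sa cx c'x E; rewrite (family_ur_chart Sa cx c'x) E mulmx0 mul0mx. Qed.

(** The determinant of the bivector is continuous in the chart. *)
Lemma nondegenerate_nbhs a c x : S2 a -> dom c x -> ursubmx (F a c x) \in unitmx ->
  nbhs x [set y | dom c y /\ ursubmx (F a c y) \in unitmx].
Proof.
move=> Sa cx uP; pose g u := \det (ursubmx (F a c (par c u))).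
have gT : gen_complex [set: M] (F a) by exact: family_gc.
have oV : open (readout c [set: M]) by apply: open_readout; exact: openT.
have Vx : readout c [set: M] (crd c x) by exact: readout_crd.
have sg : smooth_on (readout c [set: M]) g.
  apply: smooth_on_det => // i j.
  apply: eq_smooth_on (smooth_mx_read c (gc_smooth gT) (lshift m i) (rshift m j)) => //.
  by move=> u _; rewrite !mxE.
have cg : {for crd c x, continuous g} by exact: smooth_on_continuous sg Vx.
have gx : g (crd c x) != 0 by rewrite /g crdK // -unitfE -unitmxE.
have ng : \forall u \near crd c x, g u != 0.
  have : \forall z \near g (crd c x), z != 0.
    by apply: open_nbhs_nbhs; split; [exact: open_neq|].
  exact: cg.
have nx : \forall y \near x, g (crd c y) != 0 by exact: (crd_continuous cx) ng.
have nd : nbhs x (dom c) by apply: open_nbhs_nbhs; split=> //; exact: dom_open.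
apply: filterS2 nx nd => y gy cy; split=> //.
by move: gy; rewrite /g crdK // -unitfE -unitmxE.
Qed.

End FamilyCharts.

(** * Points of maximal type: hypercomplex structures twisted by a 2-form *)

Section Twisted.
Variables (R : realType) (m : nat) (M : smooth_manifold R m).
Variables I J K : tfield M (m + m) (m + m).
Hypothesis hIJK : gen_hypercomplex [set: M] I J K.
Local Notation F := (s2family I J K).
Implicit Types (a b v e : R * R * R) (U : set M) (x : M) (c : chart M).

(** The complement given by twist is invariant under the whole family at once. *)
Lemma twisted_of_ur0 U : open U ->
  everywhere U (fun c y => [/\ ursubmx (I c y) = 0, ursubmx (J c y) = 0 & ursubmx (K c y) = 0]) ->
  twisted_hypercomplex U F.
Proof.
move=> oU E0.
have [gI gJ gK hQ gF] := hIJK.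
have sT : U `<=` [set: M] by [].
have {}gI := gen_complex_sub sT gI; have {}gJ := gen_complex_sub sT gJ.
have {}gK := gen_complex_sub sT gK.
have {}gF a Sa := gen_complex_sub sT (gF a Sa).
pose tI := tangent_part I; pose tJ := tangent_part J; pose tK := tangent_part K.
pose sI c x := dlsubmx (I c x); pose sJ c x := dlsubmx (J c x).
pose sK c x := dlsubmx (K c x).
have tri (E : tfield M (m + m) (m + m)) c y : gen_complex U E -> ursubmx (E c y) = 0 ->
    U y -> dom c y -> E c y = triangular_mx (tangent_part E c y) (dlsubmx (E c y)).
  move=> gE Ey0 Uy cy; have [D _ _] := gc_blocks gE Uy cy.
  by rewrite -[LHS]submxK Ey0 D.
have triI c y : U y -> dom c y -> I c y = triangular_mx (tI c y) (sI c y).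
  by move=> Uy cy; apply: tri => //; have [] := E0 c y Uy cy.
have triJ c y : U y -> dom c y -> J c y = triangular_mx (tJ c y) (sJ c y).
  by move=> Uy cy; apply: tri => //; have [] := E0 c y Uy cy.
have triK c y : U y -> dom c y -> K c y = triangular_mx (tK c y) (sK c y).
  by move=> Uy cy; apply: tri => //; have [] := E0 c y Uy cy.
(* the tangent part is linear in E, so it commutes with the sphere family *)
have tF a : s2family tI tJ tK a = tangent_part (F a).
  apply/funext => c; apply/funext => y; apply/matrixP => i j.
  by rewrite /tI /tJ /tK /tangent_part /s2family !mxE.
have F0 a : everywhere U (fun c y => ursubmx (F a c y) = 0).
  move=> c y Uy cy; have [/matrixP i0 /matrixP j0 /matrixP k0] := E0 c y Uy cy.
  apply/matrixP => i j; move: (i0 i j) (j0 i j) (k0 i j).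
  by rewrite /s2family !mxE => -> -> ->; rewrite !mulr0 !addr0.
pose B : tfield M m m := fun c y =>
  twist (tI c y) (tJ c y) (tK c y) (sI c y) (sJ c y) (sK c y).
have table c y : U y -> dom c y ->
    [/\ I c y *m J c y = K c y, J c y *m I c y = - K c y, J c y *m K c y = I c y,
       K c y *m J c y = - I c y & K c y *m I c y = J c y /\ I c y *m K c y = - J c y].
  move=> Uy cy; have [IJ JI KI KJ] := hQ c y Logic.I cy.
  have II := gc_square gI Uy cy; have JJ := gc_square gJ Uy cy.
  have ji : J c y *m I c y = - K c y by rewrite -IJ JI opprK.
  have jk : J c y *m K c y = I c y.
    by rewrite -IJ mulmxA ji -IJ mulNmx -mulmxA JJ mulmxN mulmx1 opprK.
  have ik : I c y *m K c y = - J c y by rewrite -IJ mulmxA II mulNmx mul1mx.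
  split=> //; first by rewrite -[K c y *m J c y]opprK -KJ jk.
  by split=> //; rewrite -[K c y *m I c y]opprK -KI ik opprK.
have BI c y : U y -> dom c y -> B c y *m tI c y + (tI c y)^T *m B c y = sI c y.
  move=> Uy cy; have [t1 t2 t3 t4 [t5 t6]] := table c y Uy cy.
  have II := gc_square gI Uy cy; have JJ := gc_square gJ Uy cy.
  have KK := gc_square gK Uy cy.
  by apply: twist_identity; rewrite -?triI -?triJ -?triK.
have BJ c y : U y -> dom c y -> B c y *m tJ c y + (tJ c y)^T *m B c y = sJ c y.
  move=> Uy cy; have [t1 t2 t3 t4 [t5 t6]] := table c y Uy cy; rewrite /B twist_rot.
  have II := gc_square gI Uy cy; have JJ := gc_square gJ Uy cy.
  have KK := gc_square gK Uy cy.
  by apply: twist_identity; rewrite -?triI -?triJ -?triK.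
have BK c y : U y -> dom c y -> B c y *m tK c y + (tK c y)^T *m B c y = sK c y.
  move=> Uy cy; have [t1 t2 t3 t4 [t5 t6]] := table c y Uy cy; rewrite /B 2!twist_rot.
  have II := gc_square gI Uy cy; have JJ := gc_square gJ Uy cy.
  have KK := gc_square gK Uy cy.
  by apply: twist_identity; rewrite -?triI -?triJ -?triK.
have oV c : open (readout c U) by exact: open_readout.
have sdl (E : tfield M (m + m) (m + m)) c : smooth_field U E ->
    smooth_mx (readout c U) (fun u => dlsubmx (E c (par c u))).
  move=> sE i j; apply: (eq_smooth_on (oV c) _ (sE c (rshift m i) (lshift m j))) => u _.
  by rewrite !mxE.
have skew (E : tfield M (m + m) (m + m)) c y : gen_complex U E -> U y -> dom c y ->
    (dlsubmx (E c y) *m tangent_part E c y)^T = - (dlsubmx (E c y) *m tangent_part E c y).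
  move=> gE Uy cy; have [D _ S] := gc_blocks gE Uy cy.
  have [_ _ H] := square_blocks (gc_square gE Uy cy) D.
  by rewrite trmx_mul S mulmxN; congr (- _); exact: esym H.
have tens (E : tfield M (m + m) (m + m)) c c' y (T := trans c c' y) :
    gen_complex U E -> U y -> dom c y -> dom c' y ->
    T^T *m (dlsubmx (E c' y) *m tangent_part E c' y) *m T =
    dlsubmx (E c y) *m tangent_part E c y.
  move=> gE Uy cy c'y; have [H1 _ H2] := gc_trans_blocks gE Uy cy c'y.
  by rewrite -mulmxA -[_ *m _ *m T]mulmxA H1 !mulmxA H2.
have fB : form2 U B.
  split.
  - move=> c; apply: (smooth_mx_scale (oV c)); first exact: smooth_on_cst.
    have sm (E : tfield M (m + m) (m + m)) : gen_complex U E ->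
        smooth_mx (readout c U) (fun u => dlsubmx (E c (par c u)) *m tangent_part E c (par c u)).
      move=> gE; apply: (smooth_mx_mul (oV c)).
        by apply: sdl; exact: gc_smooth gE.
      exact: smooth_tangent_part gE c.
    apply: (smooth_mx_add (oV c)); last exact: sm.
    by apply: (smooth_mx_add (oV c)); exact: sm.
  - move=> c y Uy cy; rewrite /B /twist [LHS]linearZ /= -[RHS]scalerN; congr (_ *: _).
    by rewrite [LHS]linearD [X in X + _]linearD /= !skew // !opprD.
  - move=> c c' y Uy cy c'y; rewrite /B /twist -scalemxAr -scalemxAl !mulmxDr !mulmxDl.
    by rewrite !tens.
exists tI, tJ, tK, B, (fun=> fun c y => 0); split.
- split; try by apply: complex_structure_tangent_part => // c y Uy cy; have [] := E0 c y Uy cy.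
    move=> c y Uy cy; have [IJ JI KI KJ] := hQ c y Logic.I cy.
    move: IJ JI KI KJ; rewrite triI // triJ // triK // !triangular_mxM !opp_block_mx.
    by move=> /eq_block_mx[-> _ _ _] /eq_block_mx[-> _ _ _] /eq_block_mx[-> _ _ _]
      /eq_block_mx[-> _ _ _].
  move=> a Sa; rewrite tF; apply: complex_structure_tangent_part => //.
  exact: gF.
- exact: fB.
- move=> a Sa; split; first by move=> c; exact: smooth_mx_cst.
    by move=> c y _ _; rewrite trmx0 oppr0.
  by move=> c c' y _ _ _; rewrite mulmx0 mul0mx.
- by move=> a a' Sa Sa' c y Uy cy; exact: type20_02_0.
move=> a Sa c y Uy cy; rewrite -[RHS]/(Ad_mx (B c y + 0) (cplx_mx _)) addr0 Ad_cplx_mx.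
rewrite -[LHS]/(a.1.1 *: I c y + a.1.2 *: J c y + a.2 *: K c y) triI // triJ // triK //.
rewrite /triangular_mx !scale_block_mx !add_block_mx !scaler0 !addr0 /s2family.
have -> : (a.1.1 *: tI c y + a.1.2 *: tJ c y + a.2 *: tK c y)^T =
    a.1.1 *: (tI c y)^T + a.1.2 *: (tJ c y)^T + a.2 *: (tK c y)^T.
  by apply/matrixP => i j; rewrite !mxE.
congr block_mx; last by rewrite !scalerN !opprD.
rewrite -BI // -BJ // -BK //; move: (B c y) => b.
rewrite !mulmxDr !mulmxDl -!scalemxAr -!scalemxAl !scalerDr.
by rewrite [X in X + _ = _]addrACA [LHS]addrACA.
Qed.

(** Three independent directions can be reached inside the open set, and the
    bivector of F(a) is linear in a. *)
Lemma twisted_of_open_ur0 (W : set (M * (R * R * R))) x a0 : open_in_twistor W ->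
  (forall y a, W (y, a) -> exists2 c, dom c y & ursubmx (F a c y) = 0) ->
  W (x, a0) -> exists U : set M, [/\ open U, U x & twisted_hypercomplex U F].
Proof.
move=> [Ow [oO WO]] HW Wx; have [Ox S0] : (Ow `&` @twistor_space R m M) (x, a0) by rewrite -WO.
have [[A Q] [/= nA nQ] AQ] : nbhs (x, a0) Ow by exact: open_nbhs_nbhs.
have zero y a c : A y -> Q a -> S2 a -> dom c y -> ursubmx (F a c y) = 0.
  move=> Ay Qa Sa cy; have [|c' c'y E] := HW y a; first by rewrite WO; split=> //; exact: AQ.
  exact: (family_ur0 hIJK Sa c'y cy E).
have zero' e y c : A y -> dom c y -> ursubmx (F e c y) = 0.
  move=> Ay cy; have [s [s0 n0 Qs]] := unit3_line_near e S0 nQ.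
  have := zero y _ c Ay Qs (unit3_S2 n0) cy.
  rewrite family_ur_scale3 => /eqP; rewrite scaler_eq0 invr_eq0 (negPf (sqrt_dot3 n0)) /=.
  have /matrixP a00 := zero y a0 c Ay (nbhs_singleton nQ) S0 cy.
  move=> /eqP/matrixP v0; apply/matrixP => i j.
  have := v0 i j; have := a00 i j; rewrite family_lin3 !mxE => -> H.
  by move: H; rewrite !mulr0 add0r addr0 => /eqP; rewrite mulf_eq0 (negPf s0) => /eqP.
exists A°; split=> //; first exact: open_interior.
apply: twisted_of_ur0; first exact: open_interior.
move=> c y /interior_subset Ay cy; split.
- by rewrite -(zero' (1, 0, 0) y c) // /s2family /= scale1r !scale0r !addr0.
- by rewrite -(zero' (0, 1, 0) y c) // /s2family /= scale1r !scale0r addr0 add0r.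
- by rewrite -(zero' (0, 0, 1) y c) // /s2family /= scale1r !scale0r !add0r.
Qed.

End Twisted.

(** * Points of minimal type: the symplectic normal form *)

Section Symplectic.
Variables (R : realType) (m : nat) (M : smooth_manifold R m).
Variables I J K : tfield M (m + m) (m + m).
Hypothesis hIJK : gen_hypercomplex [set: M] I J K.
Local Notation F := (s2family I J K).
Implicit Types (a b v e : R * R * R) (U : set M) (x : M) (c : chart M).

(** B0 and w1 are the parts of F(a0), w2 the symplectic part of F(a1), and B the
    difference of the two B-parts. *)
Lemma exists_symplectic_normal_form a0 c0 x : S2 a0 -> dom c0 x ->
  ursubmx (F a0 c0 x) \in unitmx ->
  exists (U : set M) (B0 w1 w2 B : tfield M m m) (p : R),
    symplectic_normal_form F x U B0 w1 w2 B p.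
Proof.
move=> S0 c0x u0.
have [e e0] := independent_direction S0.
have [s s0 us] := generic_pencil_unit (ursubmx (F e c0 x)) u0.
pose v := lin3 1 a0 s e 0 a0; pose a1 := unit3 v.
have /S2E n0 := S0.
have gv : dot3 (cross3 a0 v) (cross3 a0 v) = s ^+ 2 * dot3 (cross3 a0 e) (cross3 a0 e).
  by rewrite /v /dot3 /cross3 /lin3 /=; ring.
have v0 : dot3 v v != 0.
  apply/eqP => v0; have := gv; rewrite cross3_norm v0 mulr0 sub0r => H.
  have : s ^+ 2 * dot3 (cross3 a0 e) (cross3 a0 e) > 0.
    by rewrite mulr_gt0 // ?exprn_even_gt0 // lt0r e0 dot3_ge0.
  by rewrite -H oppr_gt0 ltNge sqr_ge0.
have S1 : S2 a1 by exact: unit3_S2.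
have /S2E n1 := S1.
have g0 : dot3 (cross3 a0 a1) (cross3 a0 a1) != 0.
  have -> : cross3 a0 a1 = scale3 (Num.sqrt (dot3 v v))^-1 (cross3 a0 v).
    by rewrite /a1 /unit3 /cross3 /scale3 /=; congr (_, _, _); ring.
  rewrite dot3_scale3 gv; apply: mulf_neq0; last by apply: mulf_neq0; rewrite ?expf_neq0.
  by rewrite expf_neq0 // invr_eq0 sqrt_dot3.
have u1 : ursubmx (F a1 c0 x) \in unitmx.
  rewrite family_ur_scale3 unitmxZ ?unitfE ?invr_eq0 ?sqrt_dot3 //.
  rewrite (_ : ursubmx _ = ursubmx (F a0 c0 x) + s *: ursubmx (F e c0 x)) //.
  by apply/matrixP => i j; rewrite family_lin3 !mxE; ring.
(* nondegeneracy is tested in the single chart c0 and carried to the others *)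
pose S := [set y | (dom c0 y /\ ursubmx (F a0 c0 y) \in unitmx) /\
                   (dom c0 y /\ ursubmx (F a1 c0 y) \in unitmx)].
have nS : nbhs x S.
  exact: filterI (nondegenerate_nbhs hIJK S0 c0x u0) (nondegenerate_nbhs hIJK S1 c0x u1).
pose U := S°.
have oU : open U by exact: open_interior.
have Ux : U x by [].
have U0 : everywhere U (fun c y => ursubmx (F a0 c y) \in unitmx).
  move=> c y /interior_subset[[c0y uy] _] cy; exact: family_ur_unit hIJK _ _ _ _ S0 c0y cy uy.
have U1 : everywhere U (fun c y => ursubmx (F a1 c y) \in unitmx).
  move=> c y /interior_subset[_ [c0y uy]] cy; exact: family_ur_unit hIJK _ _ _ _ S1 c0y cy uy.
have gc0 : gen_complex U (F a0) by exact: family_gc.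
have gc1 : gen_complex U (F a1) by exact: family_gc.
have [sw1 cB0] := gc_symplectic oU gc0 U0.
have [sw2 cB1] := gc_symplectic oU gc1 U1.
pose p := - dot3 a0 a1.
set B0 := B_field (F a0) in cB0; set w1 := symp_field (F a0) in sw1.
set B1 := B_field (F a1) in cB1; set w2 := symp_field (F a1) in sw2.
pose B : tfield M m m := fun c y => B1 c y - B0 c y.
have E0 c y : U y -> dom c y -> F a0 c y = Ad_mx (B0 c y) (gc_of_symplectic w1 c y).
  by move=> Uy cy; exact: (gc_normal_form gc0 U0 Uy cy).
have E1 c y : U y -> dom c y -> F a1 c y = Ad_mx (B0 c y) (gc_of_B_symplectic w2 B c y).
  move=> Uy cy; rewrite (gc_normal_form gc1 U1 Uy cy).
  rewrite -[gc_of_B_symplectic w2 B c y]/(block_mx _ _ _ _) -Ad_symp_mx Ad_mx_comp.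
  by rewrite addrC subrK.
have anti : everywhere U (fun c y => gc_of_symplectic w1 c y *m gc_of_B_symplectic w2 B c y
    + gc_of_B_symplectic w2 B c y *m gc_of_symplectic w1 c y = (2%:R * p)%:M).
  move=> c y Uy cy; apply: (@Ad_mx_inj _ _ (B0 c y)).
  rewrite Ad_mxD !Ad_mxM -E0 // -E1 // (family_anticomm hIJK) // -[(2%:R * p)%:M]scalemx1.
  by rewrite Ad_mxZ Ad_mx1 /p mulrN mulNr.
have p1 : `|p| < 1.
  rewrite -(@ltr_pXn2r _ 2) ?nnegrE // expr1n real_normK ?num_real // /p sqrrN.
  rewrite -subr_gt0; move: (cross3_norm a0 a1); rewrite n0 n1 mulr1 => <-.
  by rewrite lt0r g0 dot3_ge0.
exists U, B0, w1, w2, B, p; split=> //.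
- by split=> //; exact: closed_form2_sub.
- move=> c y Uy cy; have := anti c y Uy cy.
  rewrite -[gc_of_B_symplectic w2 B c y]/(block_mx _ _ _ _) -Ad_symp_mx.
  by apply: anticomm_relations; [case: sw1 => _; exact|case: sw2 => _; exact].
- exact: (Ad_determined_span hIJK Ux S0 S1 g0).
Qed.

End Symplectic.

(** * Holomorphic symplectic families *)

(** In dimension 0 all matrices coincide.  This case is separate because the zero
    matrix is then invertible. *)
Lemma transformed_dim0 (R : realType) (m : nat) (M : smooth_manifold R m)
    (F : R * R * R -> tfield M (m + m) (m + m)) (U : set M) : m = 0%N ->
  transformed_holomorphic_symplectic U F.
Proof.
move=> m0; have E k l (A B : 'M[R]_(k, l)) : k = 0%N -> A = B by exact: mx0_eq.
have E2 (A B : 'M[R]_(m + m)) : A = B by apply: E; rewrite m0.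
have no (i : 'I_m) : False by have := ltn_ord i; rewrite {2}m0.
pose z : tfield M m m := fun _ _ => 0.
have cz B : closed_form2 U B.
  split; first split.
  - by move=> c i; case: (no i).
  - by move=> c x _ _; exact: E.
  - by move=> c c' x _ _ _; exact: E.
  - by move=> c x _ _ i; case: (no i).
exists z, z, z; split=> //.
- split; first split.
  + by move=> c i; case: (no i).
  + by move=> c c' x _ _ _; exact: E.
  + by move=> c x _ _; exact: E.
  + by move=> c x _ _ i; case: (no i).
  split=> // c x _ _; rewrite (_ : z c x = 1%:M) ?unitmx1 //; exact: E.
- by move=> c x _ _; exact: E.
- left; split=> // c x _ _ Z _; first by apply/colP => i; case: (no i).
  by move=> _; apply/colP => i; case: (no i).
- split=> [a Sa|T _].
    exists (gc_of_complex z); split; last by move=> c x _ _; exact: E2.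
    split; last by move=> c x _ _; exact: E2.
    by exists 0, 0, 0 => c x _ _; exact: E2.
  exists (1, 0, 0); split; last by move=> c x _ _; exact: E2.
  by rewrite /S2 /= expr1n expr0n /= !addr0.
Qed.

Section HolomorphicSymplectic.
Variables (R : realType) (m : nat) (M : smooth_manifold R m).
Variables I J K : tfield M (m + m) (m + m).
Hypothesis hIJK : gen_hypercomplex [set: M] I J K.
Local Notation F := (s2family I J K).
Implicit Types (a b v e : R * R * R) (U : set M) (x : M) (c : chart M).

(** J comes from the member F(v) without bivector.  Removing from a1 its component
    along v does not change the bivector, so the orthogonal member it yields is
    still of symplectic kind and defines w. *)
Lemma holomorphic_symplectic_of_family U v a1 x : (0 < m)%N -> open U -> U x ->
  dot3 v v != 0 -> S2 a1 ->
  everywhere U (fun c y => ursubmx (F v c y) = 0) ->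
  everywhere U (fun c y => ursubmx (F a1 c y) \in unitmx) ->
  transformed_holomorphic_symplectic U F.
Proof.
move=> m0 oU Ux v0 S1 Fv0 F1u.
pose as_ := unit3 v; have Ss : S2 as_ by exact: unit3_S2.
pose t := dot3 a1 as_; pose q := lin3 1 a1 (- t) as_ 0 as_.
have Fs0 : everywhere U (fun c y => ursubmx (F as_ c y) = 0).
  by move=> c y Uy cy; rewrite family_ur_scale3 Fv0 // scaler0.
have Fq : everywhere U (fun c y => ursubmx (F q c y) = ursubmx (F a1 c y)).
  move=> c y Uy cy; have /matrixP E := Fs0 c y Uy cy.
  apply/matrixP => i j; have := E i j; rewrite family_lin3 !mxE => ->; ring.
have q0 : dot3 q q != 0.
  apply/eqP => /dot3_eq0 q0; have [c cx] := dom_cover x.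
  have := mx_pos_unit m0 (F1u c x Ux cx); rewrite -Fq // q0.
  rewrite (_ : ursubmx _ = 0) ?eqxx //.
  by apply/matrixP => i j; rewrite !mxE /= !mul0r !addr0.
pose aP := unit3 q; have SP : S2 aP by exact: unit3_S2.
have FPu : everywhere U (fun c y => ursubmx (F aP c y) \in unitmx).
  move=> c y Uy cy; rewrite family_ur_scale3 unitmxZ ?Fq ?F1u //.
  by rewrite unitfE invr_eq0 sqrt_dot3.
have /S2E ns := Ss; have /S2E nP := SP.
have sP : dot3 as_ aP = 0.
  have E : dot3 as_ q = 0.
    have -> : dot3 as_ q = t - t * dot3 as_ as_.
      by rewrite /q /t; move: (as_) => b; rewrite /dot3 /lin3 /=; ring.
    by rewrite ns mulr1 subrr.
  rewrite /aP /unit3; set k := _^-1.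
  have -> : dot3 as_ (scale3 k q) = k * dot3 as_ q.
    by move: (as_) (q) => b d; rewrite /dot3 /scale3 /=; ring.
  by rewrite E mulr0.
pose aQ := cross3 as_ aP.
have nQ : dot3 aQ aQ = 1 by rewrite cross3_norm ns nP sP mulr1 expr0n subr0.
have SQ : S2 aQ by apply/S2E.
have gs : gen_complex U (F as_) by exact: family_gc.
have gP : gen_complex U (F aP) by exact: family_gc.
have gQ : gen_complex U (F aQ) by exact: family_gc.
pose Jf := tangent_part (F as_); pose w := symp_field (F aP); pose B := B_field (F aP).
have cJ : complex_structure U Jf by exact: complex_structure_tangent_part.
have [sw cB] := gc_symplectic oU gP FPu.
have nfP c y : U y -> dom c y -> F aP c y = Ad_mx (B c y) (symp_mx (w c y)).
  by move=> Uy cy; exact: (gc_normal_form gP FPu Uy cy).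
have [_ uw] := sw.
have H c y : U y -> dom c y -> F as_ c y = Ad_mx (B c y) (cplx_mx (Jf c y)) /\
    w c y *m Jf c y = (Jf c y)^T *m w c y.
  move=> Uy cy; have [D _ _] := gc_blocks gs Uy cy.
  apply: anticomm_cplx => //; [exact: uw|exact: Fs0|].
  by rewrite -nfP // family_anticomm // sP mulr0 scale0r.
have JJ c y : U y -> dom c y -> Jf c y *m Jf c y = - 1%:M by case: cJ => _ _ + _; exact.
have HQ c y : U y -> dom c y -> ursubmx (F aQ c y) \in unitmx /\
    symp_field (F aQ) c y = - (w c y *m Jf c y).
  move=> Uy cy; have [Hs wJ] := H c y Uy cy.
  have FQ : F aQ c y = Ad_mx (B c y) (cplx_mx (Jf c y)) *m Ad_mx (B c y) (symp_mx (w c y)).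
    by rewrite -Hs -nfP // (familyM hIJK) // sP oppr0 scale0r add0r.
  by rewrite /symp_field FQ; apply: cplx_symp_ur => //; [exact: uw|exact: JJ].
have [[cQ _] _] : symplectic U (symp_field (F aQ)) /\ closed_form2 U (B_field (F aQ)).
  by apply: gc_symplectic => // c y Uy cy; have [] := HQ c y Uy cy.
(* - w J is the symplectic part of the third member *)
have cwJ : closed_form2 U (fun c y => - (w c y *m Jf c y)).
  by apply: (eq_closed_form2 oU _ cQ) => c y Uy cy; have [] := HQ c y Uy cy.
have ii : 'i%C * 'i%C = -1 :> R[i] by rewrite -expr2 sqr_i.
have toCwJ c y : toC (- (w c y *m Jf c y)) = - (toC (w c y) *m toC (Jf c y)).
  by rewrite -toC_mul /toC map_mxN.
exists B, Jf, w; split=> //.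
- by move=> c y Uy cy; have [] := H c y Uy cy.
- right; split => //; first by case: sw.
    move=> c y Uy cy W JW.
    rewrite /= toCwJ mulmxDl -scalemxAl mulNmx -mulmxA JW.
    by rewrite -scalemxAr scaleNr opprK scalerA ii scaleN1r subrr.
  move=> c y Uy cy Z JZ.
  rewrite /= toCwJ mulmxDl -scalemxAl mulNmx -mulmxA JZ.
  rewrite -scalemxAr scalerN scalerA ii scaleN1r opprK -mulr2n -scaler_nat.
  move/eqP; rewrite scaler_eq0 pnatr_eq0 /= => /eqP wZ.
  have uwC : toC (w c y) \in unitmx by rewrite /toC map_unitmx; exact: uw.
  by apply: (can_inj (mulKmx uwC)); rewrite wZ mulmx0.
- apply: (Ad_determined_span hIJK Ux Ss SP) => //.
    by rewrite -/aQ nQ oner_neq0.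
  by move=> c y Uy cy; have [] := H c y Uy cy.
Qed.

(** The combination of I1, I2 and [I1, I2] singled out by span_ur is the member
    F(v), and I1 itself is a member with invertible bivector. *)
Lemma transformed_of_normal_form x U B0 w1 w2 B p (al be ga gamma theta : R) : (0 < m)%N ->
  symplectic_normal_form F x U B0 w1 w2 B p -> (al, be, ga) != (0, 0, 0) ->
  everywhere U (fun k y => ga *: B k y = al *: w2 k y + be *: w1 k y) -> theta < 0 ->
  everywhere U (fun k y =>
    let N := invmx (w2 k y) *m w1 k y + gamma%:M in N *m N = theta%:M) ->
  transformed_holomorphic_symplectic U F.
Proof.
move=> m0 [[oU Ux p1] [cB0 [_ uw1] [_ uw2] cB] anti _ [_ AD]] n0 BE th0 HN.
have [c cx] := dom_cover x; have u2 := uw2 c x Ux cx; have u1 := uw1 c x Ux cx.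
(* if ga = 0, then w1 is a multiple of w2 and N a real scalar of negative square *)
have ga0 : ga != 0.
  apply: contraNneq n0 => ga0; have := BE c x Ux cx; rewrite ga0 scale0r => /esym H.
  have [be0|be0] := eqVneq be 0.
    have [->|al0] := eqVneq al 0; first by rewrite be0.
    have := mx_pos_unit m0 u2; move/eqP: H.
    by rewrite be0 scale0r addr0 scaler_eq0 (negPf al0) => /= ->.
  have := HN c x Ux cx; have -> : w1 c x = (- (al / be)) *: w2 c x.
    apply: (scalerI be0); rewrite scalerA mulrN mulrCA mulfV // mulr1 scaleNr.
    by apply/eqP; rewrite -addr_eq0 addrC H.
  rewrite /= -scalemxAr mulVmx // -[gamma%:M]scalemx1 -scalerDl -scalemxAl -scalemxAr.
  rewrite mul1mx scalerA -[RHS]scalemx1.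
  move=> /(scalar1_inj m0); rewrite -expr2 => E.
  by have := sqr_ge0 (- (al / be) + gamma); rewrite E leNgt th0.
have sq1 : everywhere U (fun c y => gc_of_symplectic w1 c y *m gc_of_symplectic w1 c y = - 1%:M).
  by move=> k y Uy ky; apply: symp_mx_square; exact: uw1.
have sq2 : everywhere U (fun c y =>
    gc_of_B_symplectic w2 B c y *m gc_of_B_symplectic w2 B c y = - 1%:M).
  move=> k y Uy ky; rewrite -[gc_of_B_symplectic w2 B k y]/(block_mx _ _ _ _) -Ad_symp_mx.
  by rewrite -Ad_mxM symp_mx_square ?Ad_mxN ?Ad_mx1 //; exact: uw2.
have [|a1 [S1 E1]] := AD (gc_of_symplectic w1).
  split=> //; exists 1, 0, 0 => k y Uy ky; by rewrite scale1r !scale0r !addr0.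
have [|a2 [S2' E2]] := AD (gc_of_B_symplectic w2 B).
  split=> //; exists 0, 1, 0 => k y Uy ky; by rewrite scale1r !scale0r !addr0 add0r.
have /S2E n1 := S1; have /S2E n2 := S2'.
have pE : p = - dot3 a1 a2.
  have := anti c x Ux cx => /(congr1 (Ad_mx (B0 c x))).
  rewrite Ad_mxD !Ad_mxM -[Ad_mx _ _]/(Ad_exp B0 (gc_of_symplectic w1) c x).
  rewrite -[Ad_mx _ (gc_of_B_symplectic w2 B c x)]/(Ad_exp B0 (gc_of_B_symplectic w2 B) c x).
  rewrite -E1 // -E2 // (family_anticomm hIJK) // -[(2%:R * p)%:M]scalemx1 Ad_mxZ Ad_mx1.
  move=> /scalar1_inj H; apply: (@mulfI _ (2%:R : R)); first by rewrite pnatr_eq0.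
  by rewrite -H ?addn_gt0 ?m0 // mulrN mulNr.
pose a' := al / ga; pose b' := be / ga.
pose v := lin3 a' a1 b' a2 1 (cross3 a1 a2).
have v0 : dot3 v v != 0.
  have -> : dot3 v v = dot3 (lin3 a' a1 b' a2 0 a1) (lin3 a' a1 b' a2 0 a1) +
      (dot3 a1 a1 * dot3 a2 a2 - dot3 a1 a2 ^+ 2).
    by rewrite /v /dot3 /lin3 /cross3 /=; ring.
  rewrite gt_eqF // ltr_wpDl ?dot3_ge0 // n1 n2 mulr1 subr_gt0 -(sqrrN (dot3 a1 a2)) -pE.
  by rewrite -real_normK ?num_real // -(expr1n R 2) ltr_pXn2r ?nnegrE.
apply: (holomorphic_symplectic_of_family m0 oU Ux v0 S1) => k y Uy ky; last first.
  by rewrite E1 // Ad_mx_ur block_mxKur unitmxN unitmx_inv; exact: uw1.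
have FE : F v k y = Ad_mx (B0 k y) (a' *: gc_of_symplectic w1 k y +
    b' *: gc_of_B_symplectic w2 B k y + 2%:R^-1 *:
    (gc_of_symplectic w1 k y *m gc_of_B_symplectic w2 B k y
     - gc_of_B_symplectic w2 B k y *m gc_of_symplectic w1 k y)).
  have e1 : F a1 k y = Ad_mx (B0 k y) (gc_of_symplectic w1 k y) by exact: E1.
  have e2 : F a2 k y = Ad_mx (B0 k y) (gc_of_B_symplectic w2 B k y) by exact: E2.
  rewrite !Ad_mxD !Ad_mxZ Ad_mxD Ad_mxN !Ad_mxM -e1 -e2 (family_comm hIJK) //.
  by rewrite scalerA mulVf ?pnatr_eq0 // /v family_lin3.
rewrite FE Ad_mx_ur -[gc_of_B_symplectic w2 B k y]/(block_mx _ _ _ _) -Ad_symp_mx.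
apply: span_ur; [exact: uw1|exact: uw2|].
apply: (scalerI ga0); rewrite BE // scalerDr !scalerA.
by rewrite /a' /b' !(mulrCA ga) !mulfV // !mulr1.
Qed.

End HolomorphicSymplectic.

Theorem theorem4p4 (R : realType) (n : nat) (M : smooth_manifold R (4 * n))
    (I J K : tfield M (4 * n + 4 * n) (4 * n + 4 * n))
    (hIJK : gen_hypercomplex [set: M] I J K) :
  let F := s2family I J K in
  [/\ (* (1) *)
      forall W : set (M * (R * R * R)),
        open_in_twistor W ->
        (forall x a, W (x, a) -> twistor_type F x a (2 * n + 1)) ->
        forall x a0, W (x, a0) ->
        exists U : set M, [/\ open U, U x & twisted_hypercomplex U F],
      (* (2) *)
      forall (x : M) (a0 : R * R * R),
        S2 a0 -> twistor_type F x a0 1 ->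
        exists (U : set M) (B0 w1 w2 B : tfield M (4 * n) (4 * n)) (p : R),
          symplectic_normal_form F x U B0 w1 w2 B p &
      (* (3) *)
      forall (x : M) (a0 : R * R * R),
        S2 a0 -> twistor_type F x a0 1 ->
        forall (U : set M) (B0 w1 w2 B : tfield M (4 * n) (4 * n)) (p : R),
        symplectic_normal_form F x U B0 w1 w2 B p ->
        forall a b c : R, (a, b, c) != (0, 0, 0) ->
        everywhere U (fun k y => c *: B k y = a *: w2 k y + b *: w1 k y) ->
        forall gamma theta : R, theta < 0 ->
        everywhere U (fun k y =>
          let N := invmx (w2 k y) *m w1 k y + gamma%:M in N *m N = theta%:M) ->
        exists U' : set M, [/\ open U', U' x, U' `<=` U &
          transformed_holomorphic_symplectic U' F]].
Proof.
move=> F; split.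
- move=> W oW HW x a0 Wx; apply: (twisted_of_open_ur0 hIJK oW _ Wx) => y a.
  by move=> /HW[c [inf [l [cy _ /twistor_type_half E]]]]; exists c.
- move=> x a0 S0 [c [inf [l [cx _ tE]]]].
  apply: (exists_symplectic_normal_form hIJK S0 cx); apply: twistor_type1 tE.
  exact: (gc_square (family_gc hIJK setT S0)).
- move=> x a0 S0 _ U B0 w1 w2 B p nf a b c abc BE gamma theta th0 HN.
  have [[oU Ux _] _ _ _ _] := nf; exists U; split=> //.
  case: (posnP (4 * n)) => [n0|n0]; first exact: transformed_dim0.
  exact: (transformed_of_normal_form hIJK n0 nf abc BE th0 HN).
Qed.
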